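(* Let $f:\mathbb{B}\to\mathbb{H}$ be an arbitrary function and assume that the $3\times 3$ Pick matrix $P_f(z_1,z_2,z_3)$ is positive semidefinite for every $(z_1,z_2,z_3)\in\mathbb{B}^3$. Then $f$ belongs to the left Schur class $\mathcal{QS}_L$; that is, there exist $f_k\in\mathbb{H}$ with $\limsup_{k\to\infty}\sqrt[k]{|f_k|}\le 1$ such that $f(z)=\sum_{k=0}^\infty z^k f_k$ for all $z\in\mathbb{B}$ (the series converging absolutely), and $|f(z)|\le 1$ for all $z\in\mathbb{B}$.
   Context: $\mathbb{H}$ denotes the real quaternions $x_0+\mathbf{i}x_1+\mathbf{j}x_2+\mathbf{k}x_3$ with $\mathbf{i}^2=\mathbf{j}^2=\mathbf{k}^2=\mathbf{ijk}=-1$; $\bar\alpha$ is the quaternionic conjugate and $|\alpha|^2=\alpha\bar\alpha$. $\mathbb{B}=\{\alpha\in\mathbb{H}:|\alpha|<1\}$. For $z_1,\dots,z_n\in\mathbb{B}$ the Pick matrix of $f$ is the quaternionic $n\times n$ matrix $P_f(z_1,\dots,z_n)=\Big[\sum_{k=0}^\infty z_i^k\,(1-f(z_i)\overline{f(z_j)})\,\bar z_j^{\,k}\Big]_{i,j=1}^n$ (the series converge absolutely); it is the unique solution $P$ of $P-TPT^*=EE^*-NN^*$ with $T=\mathrm{diag}(z_1,\dots,z_n)$, $E=(1,\dots,1)^\top$, $N=(f(z_1),\dots,f(z_n))^\top$. A quaternionic matrix $A\in\mathbb{H}^{n\times n}$ is positive semidefinite if $A=A^*$ (conjugate transpose) and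 $x^*Ax\ge 0$ for all $x\in\mathbb{H}^n$. The left Schur class $\mathcal{QS}_L$ consists of functions $f:\mathbb{B}\to\mathbb{H}$ of the form $f(z)=\sum_{k\ge0} z^k f_k$ with quaternion coefficients on the right, $\limsup_k\sqrt[k]{|f_k|}\le1$, and $|f(\alpha)|\le 1$ for all $\alpha\in\mathbb{B}$. *)

(* Defs.v *)
From Stdlib Require Import Reals.
Open Scope R_scope.

(** Real quaternions x0 + i x1 + j x2 + k x3. *)
Record H := mkH { q0 : R; q1 : R; q2 : R; q3 : R }.

Definition Hzero : H := mkH 0 0 0 0.
Definition Hone : H := mkH 1 0 0 0.
Definition Hadd (a b : H) : H :=
  mkH (q0 a + q0 b) (q1 a + q1 b) (q2 a + q2 b) (q3 a + q3 b).
Definition Hopp (a : H) : H := mkH (- q0 a) (- q1 a) (- q2 a) (- q3 a).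
Definition Hsub (a b : H) : H := Hadd a (Hopp b).
(** Hamilton product, with i^2 = j^2 = k^2 = ijk = -1. *)
Definition Hmul (a b : H) : H :=
  mkH (q0 a * q0 b - q1 a * q1 b - q2 a * q2 b - q3 a * q3 b)
      (q0 a * q1 b + q1 a * q0 b + q2 a * q3 b - q3 a * q2 b)
      (q0 a * q2 b - q1 a * q3 b + q2 a * q0 b + q3 a * q1 b)
      (q0 a * q3 b + q1 a * q2 b - q2 a * q1 b + q3 a * q0 b).
Definition Hconj (a : H) : H := mkH (q0 a) (- q1 a) (- q2 a) (- q3 a).
Fixpoint Hpow (a : H) (n : nat) : H :=
  match n with O => Hone | S n => Hmul a (Hpow a n) end.
Definition Hnorm2 (a : H) : R := q0 a ^ 2 + q1 a ^ 2 + q2 a ^ 2 + q3 a ^ 2.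
Definition Hnorm (a : H) : R := sqrt (Hnorm2 a).

Definition inB (a : H) : Prop := Hnorm a < 1.

Definition Hseries (a : nat -> H) (s : H) : Prop :=
  infinite_sum (fun k => q0 (a k)) (q0 s) /\
  infinite_sum (fun k => q1 (a k)) (q1 s) /\
  infinite_sum (fun k => q2 (a k)) (q2 s) /\
  infinite_sum (fun k => q3 (a k)) (q3 s).

Definition Habs_conv (a : nat -> H) : Prop :=
  exists l : R, infinite_sum (fun k => Hnorm (a k)) l.

(** Quaternionic n x n matrices / vectors, indexed by nat (indices < n used). *)
Definition Hmat := nat -> nat -> H.
Definition Hvec := nat -> H.

Fixpoint Hsum (n : nat) (g : nat -> H) : H :=
  match n with O => Hzero | S n => Hadd (Hsum n g) (g n) end.

Definition Hquad (n : nat) (A : Hmat) (x : Hvec) : H :=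
  Hsum n (fun i => Hsum n (fun j => Hmul (Hconj (x i)) (Hmul (A i j) (x j)))).

Definition Hpsd (n : nat) (A : Hmat) : Prop :=
  (forall i j, (i < n)%nat -> (j < n)%nat -> A i j = Hconj (A j i)) /\
  (forall x : Hvec,
     let q := Hquad n A x in
     q1 q = 0 /\ q2 q = 0 /\ q3 q = 0 /\ 0 <= q0 q).

Definition is_Pick_matrix (f : H -> H) (n : nat) (z : nat -> H) (P : Hmat) : Prop :=
  forall i j, (i < n)%nat -> (j < n)%nat ->
    Hseries (fun k => Hmul (Hpow (z i) k)
                       (Hmul (Hsub Hone (Hmul (f (z i)) (Hconj (f (z j)))))
                             (Hpow (Hconj (z j)) k)))
            (P i j).

(** limsup_k |c_k|^(1/k) <= 1, unfolded: for all eps > 0, eventually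
    |c_k|^(1/k) <= 1 + eps, i.e. |c_k| <= (1+eps)^k. *)
Definition limsup_root_le1 (c : nat -> H) : Prop :=
  forall eps : R, 0 < eps -> exists N : nat, forall k : nat, (N <= k)%nat ->
    Hnorm (c k) <= (1 + eps) ^ k.

Definition left_Schur (f : H -> H) : Prop :=
  exists c : nat -> H,
    limsup_root_le1 c /\
    (forall z : H, inB z ->
       Habs_conv (fun k => Hmul (Hpow z k) (c k)) /\
       Hseries (fun k => Hmul (Hpow z k) (c k)) (f z)) /\
    (forall z : H, inB z -> Hnorm (f z) <= 1).

(* Main.v *)
Require Import Defs.
From Stdlib Require Import Reals Lra Lia.
From Coquelicot Require Import Coquelicot.
Open Scope R_scope.

(** Expanding the Pick matrix as a series shows that positivity at three points
    means [sum_k |sum_i y_i z_i^k f(z_i)|^2 <= sum_k |sum_i y_i z_i^k|^2] for all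
    quaternions [y_i]; in particular [|sum_i y_i f(z_i)|^2] is at most the right-hand
    side.  On a slice [z = u w u^-1] with [w] complex, [u^-1 f] splits into two complex
    functions [g] of [w], and choosing the [y_i] as divided-difference weights bounds the
    second divided differences of [g] on every smaller disc.

    Such a [g] is a power series.  Shrink the circle [|w| = rho], discretised by the
    [N]-th roots of unity, towards a point [z]: up to second divided differences a radial
    difference quotient equals a tangential one, and the tangential ones telescope around
    the circle.  Hence the discrete Cauchy formula holds up to [O(1/N)], so [g] is the
    uniform limit of polynomials whose coefficients converge and are bounded by
    [rho^-k].

    Real points lie in every slice and determine the coefficients, so these do not depend
    on the slice or on [rho]. *)

Local Open Scope C_scope.

(** * Finite sums and roots of unity *)

Fixpoint csum (n : nat) (a : nat -> C) : C :=
  match n with O => 0 | S m => csum m a + a m end.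

Lemma csum_ext n (a b : nat -> C) :
  (forall k, (k < n)%nat -> a k = b k) -> csum n a = csum n b.
Proof.
induction n as [|n IH]; intros Hab; simpl; [easy|].
rewrite IH, Hab; [easy|lia|]; intros k Hk; apply Hab; lia.
Qed.

Lemma csum_plus n (a b : nat -> C) :
  csum n (fun k => a k + b k) = csum n a + csum n b.
Proof. induction n as [|n IH]; simpl; [|rewrite IH]; ring. Qed.

Lemma csum_minus n (a b : nat -> C) :
  csum n (fun k => a k - b k) = csum n a - csum n b.
Proof. induction n as [|n IH]; simpl; [|rewrite IH]; ring. Qed.

Lemma csum_scal n (c : C) (a : nat -> C) : csum n (fun k => c * a k) = c * csum n a.
Proof. induction n as [|n IH]; simpl; [|rewrite IH]; ring. Qed.

Lemma csum_const n (c : C) : csum n (fun _ => c) = INR n * c.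
Proof.
induction n as [|n IH]; [simpl; ring|].
simpl csum; rewrite IH, S_INR, RtoC_plus; ring.
Qed.

Lemma csum_exchange n m (a : nat -> nat -> C) :
  csum n (fun i => csum m (a i)) = csum m (fun j => csum n (fun i => a i j)).
Proof.
induction n as [|n IH]; simpl.
- rewrite csum_const; ring.
- now rewrite IH, csum_plus.
Qed.

Lemma csum_mod_le n (a : nat -> C) (B : R) :
  (forall k, (k < n)%nat -> (Cmod (a k) <= B)%R) ->
  (Cmod (csum n a) <= INR n * B)%R.
Proof.
induction n as [|n IH]; intros Ha.
- simpl; rewrite Cmod_0; lra.
- rewrite S_INR; simpl csum; eapply Rle_trans; [apply Cmod_triangle|].
  assert (Cmod (csum n a) <= INR n * B)%R by (apply IH; intros; apply Ha; lia).
  assert (Cmod (a n) <= B)%R by (apply Ha; lia).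
  lra.
Qed.

Lemma csum_telescope n (a : nat -> C) : csum n (fun k => a (S k) - a k) = a n - a O.
Proof. induction n as [|n IH]; simpl; [|rewrite IH]; ring. Qed.

Lemma csum_geom n (u : C) : (1 - u) * csum n (fun k => u ^ k) = 1 - u ^ n.
Proof.
induction n as [|n IH]; [simpl; ring|].
simpl csum; rewrite Cmult_plus_distr_l, IH, Cpow_S; ring.
Qed.

Lemma csum_single n i (a : nat -> C) :
  (i < n)%nat -> (forall k, (k < n)%nat -> k <> i -> a k = 0) ->
  csum n a = a i.
Proof.
induction n as [|n IH]; intros Hi Ha; [lia|]; simpl.
destruct (Nat.eq_dec i n) as [->|Hn].
- rewrite (csum_ext n a (fun _ => 0)).
  + rewrite csum_const; ring.
  + intros k Hk; apply Ha; lia.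
- rewrite IH; [rewrite (Ha n); [ring|lia|lia]|lia|].
  intros k Hk Hki; apply Ha; lia.
Qed.

Lemma csum_pad n m (a : nat -> C) :
  (n <= m)%nat -> (forall k, (n <= k)%nat -> a k = 0) -> csum m a = csum n a.
Proof.
intros Hnm Ha; induction Hnm as [|m Hnm IH]; [easy|]; simpl.
rewrite IH, Ha; [ring|lia].
Qed.

(** The right-hand side is the exact geometric sum from [n] to [m]: keeping [q ^ m] lets the
    induction on [m] close. *)
Lemma csum_tail_le (a : nat -> C) (q : R) n m :
  (0 <= q < 1)%R -> (n <= m)%nat -> (forall k, (Cmod (a k) <= q ^ k)%R) ->
  (Cmod (csum m a - csum n a) <= (q ^ n - q ^ m) / (1 - q))%R.
Proof.
intros Hq Hnm Ha; induction Hnm as [|m Hnm IH].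
- replace (csum n a - csum n a) with (RtoC 0) by ring.
  rewrite Cmod_0; unfold Rdiv; lra.
- simpl csum.
  replace (csum m a + a m - csum n a) with (csum m a - csum n a + a m) by ring.
  eapply Rle_trans; [apply Cmod_triangle|].
  eapply Rle_trans; [apply Rplus_le_compat; [apply IH|apply Ha]|].
  right; simpl; field; lra.
Qed.

Definition cis (t : R) : C := (cos t, sin t).

Lemma cis_mod t : Cmod (cis t) = 1%R.
Proof.
unfold Cmod, cis; simpl fst; simpl snd; rewrite <- !Rsqr_pow2, Rplus_comm, sin2_cos2.
apply sqrt_1.
Qed.

Lemma cis_pow t n : cis t ^ n = cis (INR n * t).
Proof.
induction n as [|n IH].
- simpl; unfold cis; rewrite Rmult_0_l, cos_0, sin_0; reflexivity.
- rewrite Cpow_S, IH, S_INR.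
  replace ((INR n + 1) * t)%R with (t + INR n * t)%R by ring.
  unfold cis, Cmult; simpl; rewrite cos_plus, sin_plus; f_equal; ring.
Qed.

(** A chord is no longer than its arc: the squared modulus is [2 - 2 cos t = 4 sin^2 (t / 2)]. *)
Lemma cis_sub_1_mod t : (0 < t)%R -> (Cmod (cis t - 1) <= t)%R.
Proof.
intros Ht; apply Rsqr_incr_0_var; [|lra].
rewrite !Rsqr_pow2, Cmod2_alt; unfold cis, Re, Im; simpl fst; simpl snd.
replace ((cos t + - (1)) ^ 2 + (sin t + - 0) ^ 2)%R
  with (2 - 2 * cos t)%R.
- replace t with (2 * (t / 2))%R at 1 by field.
  rewrite cos_2a_sin.
  assert (0 < t / 2)%R by lra.
  assert (H1 := sin_lt_x (t / 2) ltac:(lra)).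
  (* For [t <= 2] the sine is positive, since [1 < PI / 2]; for larger [t] it is at least [-1]. *)
  assert (- (t / 2) < sin (t / 2))%R.
  { destruct (Rle_lt_dec t 2).
    - assert (0 < sin (t / 2))%R; [apply sin_gt_0; [lra|]|lra].
      assert (H2 := PI2_1); lra.
    - assert (H2 := SIN_bound (t / 2)); lra. }
  assert (H3 : (0 <= (t / 2 - sin (t / 2)) * (t / 2 + sin (t / 2)))%R)
    by (apply Rmult_le_pos; lra).
  simpl; nra.
- assert (H1 := sin2_cos2 t); unfold Rsqr in H1; nra.
Qed.

Record primitive_root (N : nat) (om : C) : Prop := {
  prim_pos : (0 < N)%nat;
  prim_mod : Cmod om = 1%R;
  prim_pow : om ^ N = 1;
  prim_min : forall k, (0 < k < N)%nat -> om ^ k <> 1 }.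

Lemma primitive_root_cis N :
  (0 < N)%nat -> primitive_root N (cis (2 * PI / INR N)).
Proof.
intros HN.
assert (HN' := lt_0_INR _ HN); assert (Hpi := PI_RGT_0).
constructor.
- exact HN.
- apply cis_mod.
- rewrite cis_pow.
  replace (INR N * (2 * PI / INR N))%R with (2 * PI)%R by (field; lra).
  unfold cis; rewrite cos_2PI, sin_2PI; reflexivity.
- intros k [Hk1 Hk2]; rewrite cis_pow; intros Heq.
  (* Real parts suffice: [cos (2 x) = 1] forces [sin x = 0], whereas [x = k PI / N] lies strictly
     between [0] and [PI]. *)
  apply (f_equal fst) in Heq; simpl in Heq.
  replace (INR k * (2 * PI / INR N))%R
    with (2 * (INR k / INR N * PI))%R in Heq by (field; lra).
  rewrite cos_2a_sin in Heq.
  assert (0 < sin (INR k / INR N * PI))%R; [|nra].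
  assert (Hk := lt_0_INR _ Hk1); apply lt_INR in Hk2.
  apply sin_gt_0.
  + apply Rmult_lt_0_compat; [apply Rdiv_lt_0_compat|]; lra.
  + rewrite <- (Rmult_1_l PI) at 2; apply Rmult_lt_compat_r; [lra|].
    apply Rmult_lt_reg_r with (INR N); [lra|].
    unfold Rdiv; rewrite Rmult_assoc, Rinv_l; lra.
Qed.

Lemma Cmod_neq_0 z : (0 < Cmod z)%R -> z <> 0.
Proof. apply Cmod_gt_0. Qed.

Lemma Cminus_neq_0 (a b : C) : a <> b -> a - b <> 0.
Proof.
intros Hab E; apply Hab.
replace a with (a - b + b) by ring; rewrite E; ring.
Qed.

Lemma primitive_root_neq_0 N om : primitive_root N om -> om <> 0.
Proof.
intros Hom; apply Cmod_neq_0; rewrite (prim_mod _ _ Hom); lra.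
Qed.

Lemma Cinv_one : / RtoC 1 = 1.
Proof. rewrite <- RtoC_inv, Rinv_1; [reflexivity|lra]. Qed.

Lemma pow_diff_neq_1 N om k l :
  primitive_root N om -> (k < l < N)%nat -> om ^ l * (/ om) ^ k <> 1.
Proof.
intros Hom Hkl; assert (Ho := primitive_root_neq_0 _ _ Hom).
replace l with ((l - k) + k)%nat by lia.
rewrite Cpow_add_r, Cpow_inv by easy.
replace (om ^ (l - k) * om ^ k * / om ^ k) with (om ^ (l - k))
  by (field; now apply Cpow_nz).
apply (prim_min _ _ Hom); lia.
Qed.

(** The sum is geometric with ratio [v = om ^ (k - l)]. Since [v ^ N = 1], it vanishes as soon as
    [v <> 1]; the case [k < l] is reduced to [l < k] by inverting [v]. *)
Lemma root_orthogonality N om k l :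
  primitive_root N om -> (k < N)%nat -> (l < N)%nat ->
  csum N (fun j => (om ^ j) ^ k * (/ om ^ j) ^ l)
  = if Nat.eq_dec k l then RtoC (INR N) else 0.
Proof.
intros Hom Hk Hl; assert (Ho := primitive_root_neq_0 _ _ Hom).
set (v := om ^ k * (/ om) ^ l).
rewrite (csum_ext _ _ (fun j => v ^ j)).
2:{ intros j _; unfold v; rewrite Cpow_mult_l, <- !Cpow_inv, <- !Cpow_mult_r by easy.
    now rewrite (Nat.mul_comm k), (Nat.mul_comm l). }
destruct (Nat.eq_dec k l) as [<-|Hkl].
- assert (Hv : v = 1).
  { unfold v; rewrite Cpow_inv by easy; field; now apply Cpow_nz. }
  rewrite (csum_ext _ _ (fun _ => 1)); [rewrite csum_const; ring|].
  intros j _; rewrite Hv; apply Cpow_1_l.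
- assert (Hv : v <> 1).
  { destruct (Nat.lt_ge_cases l k).
    - apply (pow_diff_neq_1 N); [easy|lia].
    - intros Hv; apply (pow_diff_neq_1 N om k l); [easy|lia|].
      unfold v in Hv; rewrite Cpow_inv in Hv |- * by easy.
      apply (f_equal Cinv) in Hv; rewrite Cinv_one in Hv.
      rewrite <- Hv; field; split; now apply Cpow_nz. }
  assert (HvN : v ^ N = 1).
  { unfold v; rewrite Cpow_mult_l, <- !Cpow_mult_r.
    rewrite (Nat.mul_comm k), (Nat.mul_comm l), !Cpow_mult_r.
    rewrite Cpow_inv, (prim_pow _ _ Hom), Cinv_one by easy.
    rewrite !Cpow_1_l; ring. }
  assert (Hg := csum_geom N v); rewrite HvN in Hg.
  replace (csum N (fun j => v ^ j))
    with (/ (1 - v) * ((1 - v) * csum N (fun j => v ^ j))).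
  + rewrite Hg; ring.
  + field; now apply Cminus_neq_0, not_eq_sym.
Qed.

(** * Discrete Cauchy formula *)

(* The bounds [M1] and [M2] on the first and second divided differences,
   multiplied out so that coinciding points are allowed. *)
Record bounded_differences (g : C -> C) (rho M1 M2 : R) : Prop := {
  bdd_lip : forall a b, (Cmod a <= rho)%R -> (Cmod b <= rho)%R ->
    (Cmod (g a - g b) <= M1 * Cmod (a - b))%R;
  bdd_three : forall a b c,
    (Cmod a <= rho)%R -> (Cmod b <= rho)%R -> (Cmod c <= rho)%R ->
    (Cmod ((g b - g a) * (c - a) - (b - a) * (g c - g a))
     <= M2 * Cmod (b - a) * Cmod (b - c) * Cmod (c - a))%R }.

Lemma Cmod_convex (s rho : R) (z w : C) :
  (0 <= s <= 1)%R -> (Cmod z <= rho)%R -> (Cmod w <= rho)%R ->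
  (Cmod (z + s * (w - z)) <= rho)%R.
Proof.
intros Hs Hz Hw.
replace (z + s * (w - z)) with (RtoC (1 - s) * z + s * w)
  by (rewrite RtoC_minus; ring).
eapply Rle_trans; [apply Cmod_triangle|].
rewrite !Cmod_mult, !Cmod_R, !Rabs_pos_eq by lra; nra.
Qed.

(* A radial and a tangential difference quotient of [g] at the same point
   differ by a second divided difference. *)
Lemma homotopy_step g (rho M1 M2 s q : R) (z w om : C) :
  bounded_differences g rho M1 M2 -> (0 <= M2)%R -> (rho <= 1)%R ->
  (Cmod z < rho)%R -> Cmod w = rho -> Cmod om = 1%R -> om <> 1 ->
  (0 < s <= 1)%R -> (0 < q < 1)%R ->
  (Cmod ((g (z + RtoC (s * q) * (w - z)) - g (z + s * (w - z))) * (w / (w - z))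
        - (q - 1) / (om - 1) * (g (z + s * (w * om - z)) - g (z + s * (w - z))))%C
   <= M2 * (s * (1 - q)) * (2 * (1 - q) + Cmod (om - 1)))%R.
Proof.
intros Hg HM Hrho Hz Hw Hom Hom1 Hs Hq.
assert (Hrho0 := Cmod_ge_0 z).
assert (Hwz : w - z <> 0) by (apply Cminus_neq_0; intros ->; lra).
assert (Hom2 : om - 1 <> 0) by now apply Cminus_neq_0.
assert (Hw0 : w <> 0) by (apply Cmod_neq_0; lra).
assert (Hs0 : RtoC s <> 0) by (apply Cmod_neq_0; rewrite Cmod_R, Rabs_pos_eq; lra).
(* From [a], the point [b] is the next one towards [z], and [c] is the next one along the shrunken
   circle. *)
set (a := z + s * (w - z)); set (b := z + RtoC (s * q) * (w - z)).
set (c := z + s * (w * om - z)).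
assert (Hca : c - a = s * w * (om - 1)) by (unfold c, a; ring).
assert (Hba : b - a = s * (q - 1) * (w - z))
  by (unfold b, a; rewrite RtoC_mult; ring).
assert (Ha : (Cmod a <= rho)%R) by (apply Cmod_convex; lra).
assert (Hb : (Cmod b <= rho)%R) by (apply Cmod_convex; [nra|lra|lra]).
assert (Hc : (Cmod c <= rho)%R).
{ apply Cmod_convex; [lra|lra|rewrite Cmod_mult, Hw, Hom; lra]. }
assert (H3 := bdd_three _ _ _ _ Hg a b c Ha Hb Hc).
(* Dividing [X] by [s (om - 1) (w - z)] turns it into the difference of the two quotients, because
   [c - a = s w (om - 1)] and [b - a = s (q - 1) (w - z)]. *)
set (X := (g b - g a) * (c - a) - (b - a) * (g c - g a)) in H3.
replace ((g b - g a) * (w / (w - z)) - (q - 1) / (om - 1) * (g c - g a))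
  with (X / (s * (om - 1) * (w - z)))
  by (unfold X; rewrite Hca, Hba; field; repeat split; easy).
assert (Hsp : (0 < Cmod (om - 1))%R) by now apply Cmod_gt_0.
assert (Hwp : (0 < Cmod (w - z))%R) by now apply Cmod_gt_0.
assert (Hba' : Cmod (b - a) = (s * (1 - q) * Cmod (w - z))%R).
{ rewrite Hba, !Cmod_mult, <- RtoC_minus, !Cmod_R.
  rewrite (Rabs_pos_eq s), (Rabs_left (q - 1)) by lra; ring. }
assert (Hca' : Cmod (c - a) = (s * rho * Cmod (om - 1))%R).
{ rewrite Hca, !Cmod_mult, Cmod_R, Hw, (Rabs_pos_eq s) by lra; ring. }
assert (Hbc : (Cmod (b - c) <= 2 * (1 - q) + Cmod (om - 1))%R).
{ replace (b - c) with ((b - a) + - (c - a)) by ring.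
  eapply Rle_trans; [apply Cmod_triangle|]; rewrite Cmod_opp, Hba', Hca'.
  assert (Cmod (w - z) <= 2)%R.
  { eapply Rle_trans; [apply Cmod_triangle|]; rewrite Cmod_opp; lra. }
  apply Rplus_le_compat.
  - rewrite (Rmult_comm 2); apply Rmult_le_compat; nra.
  - rewrite <- (Rmult_1_l (Cmod (om - 1))) at 2.
    apply Rmult_le_compat_r; nra. }
rewrite Cmod_div.
2:{ repeat apply Cmult_neq_0; easy. }
rewrite !Cmod_mult, Cmod_R, (Rabs_pos_eq s) by lra.
apply Rmult_le_reg_r with (s * Cmod (om - 1) * Cmod (w - z))%R.
{ repeat apply Rmult_lt_0_compat; lra. }
unfold Rdiv; rewrite Rmult_assoc, Rinv_l, Rmult_1_r.
2:{ apply Rgt_not_eq; repeat apply Rmult_lt_0_compat; lra. }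
eapply Rle_trans; [exact H3|].
rewrite Hba', Hca'.
(* Both sides share the factor [D]; what remains is [rho * Cmod (b - c) <= K]. *)
set (K := (2 * (1 - q) + Cmod (om - 1))%R) in *.
set (D := (M2 * (s * (1 - q)) * (s * Cmod (om - 1) * Cmod (w - z)))%R).
assert (HD : (0 <= D)%R) by (unfold D; repeat apply Rmult_le_pos; lra).
replace (M2 * (s * (1 - q) * Cmod (w - z)) * Cmod (b - c)
         * (s * rho * Cmod (om - 1)))%R with (D * (rho * Cmod (b - c)))%R
  by (unfold D; ring).
replace (M2 * (s * (1 - q)) * K * (s * Cmod (om - 1) * Cmod (w - z)))%R
  with (D * K)%R by (unfold D; ring).
apply Rmult_le_compat_l; [exact HD|].
assert (H0 := Cmod_ge_0 (b - c)).
apply Rle_trans with (1 * Cmod (b - c))%R; [|lra].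
apply Rmult_le_compat_r; lra.
Qed.

(* [N] times the discretised Cauchy integral of [g - g z] on the circle
   obtained from [|w| = rho] by shrinking it towards [z] by the factor [s]. *)
Definition cauchy_sum (g : C -> C) (rho : R) (om z : C) (N : nat) (s : R) : C :=
  csum N (fun j => (g (z + s * (rho * om ^ j - z)) - g z)
                   * (rho * om ^ j / (rho * om ^ j - z))).

Lemma Cmod_circle N (rho : R) om j :
  primitive_root N om -> (0 <= rho)%R -> Cmod (rho * om ^ j) = rho.
Proof.
intros Hom Hrho.
rewrite Cmod_mult, Cmod_pow, (prim_mod _ _ Hom), pow1, Cmod_R, Rabs_pos_eq; lra.
Qed.

(** Each radial increment is traded for a tangential one by [homotopy_step]. The tangential
    coefficient [(q - 1) / (om - 1)] is the same at all nodes, so these increments telescope, and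
    they cancel because [om ^ N = 1] closes the polygon. *)
Lemma cauchy_sum_step g (rho M1 M2 s q : R) om z N :
  bounded_differences g rho M1 M2 -> (0 <= M2)%R -> (rho <= 1)%R ->
  (Cmod z < rho)%R -> primitive_root N om -> (1 < N)%nat ->
  (0 < s <= 1)%R -> (0 < q < 1)%R ->
  (Cmod (cauchy_sum g rho om z N (s * q) - cauchy_sum g rho om z N s)
   <= INR N * (M2 * (s * (1 - q)) * (2 * (1 - q) + Cmod (om - 1))))%R.
Proof.
intros Hg HM Hrho Hz Hom HN Hs Hq.
assert (Hrho0 := Cmod_ge_0 z).
assert (Hom1 : om <> 1).
{ rewrite <- (Cpow_1_r om); apply (prim_min _ _ Hom); lia. }
set (a := fun j => g (z + s * (rho * om ^ j - z))).
replace (cauchy_sum g rho om z N (s * q) - cauchy_sum g rho om z N s) with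
  (csum N (fun j =>
     (g (z + RtoC (s * q) * (rho * om ^ j - z)) - a j)
        * (rho * om ^ j / (rho * om ^ j - z))
     - (q - 1) / (om - 1) * (a (S j) - a j))).
- apply csum_mod_le; intros j _; unfold a.
  replace (rho * om ^ S j) with (rho * om ^ j * om) by (rewrite Cpow_S; ring).
  apply (homotopy_step g rho M1 M2); try easy.
  + apply (Cmod_circle N); [easy|lra].
  + apply (prim_mod _ _ Hom).
- rewrite csum_minus, csum_scal, csum_telescope.
  replace (a N) with (a O) by (unfold a; now rewrite (prim_pow _ _ Hom)).
  unfold cauchy_sum; rewrite <- csum_minus.
  replace (a O - a O) with (RtoC 0) by ring; rewrite Cmult_0_r.
  unfold Cminus at 1; rewrite Copp_0, Cplus_0_r.
  apply csum_ext; intros j _; unfold a; ring.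
Qed.

(** Confining [e] to the unit interval allows [1 - e] to serve as a contraction factor or a
    radius. *)
Lemma Rle_of_eps (a b k : R) :
  (forall e, (0 < e < 1)%R -> (a <= b + k * e)%R) -> (a <= b)%R.
Proof.
intros He; apply le_epsilon; intros e Hpos.
assert (Hk := Rabs_pos k).
set (d := Rmin (1 / 2) (e / (Rabs k + 1))).
assert (Hd : (0 < d < 1)%R).
{ unfold d; split.
  - apply Rmin_glb_lt; [lra|apply Rdiv_lt_0_compat; lra].
  - eapply Rle_lt_trans; [apply Rmin_l|lra]. }
specialize (He d Hd).
assert (Hde : (d * (Rabs k + 1) <= e)%R).
{ apply Rle_trans with (e / (Rabs k + 1) * (Rabs k + 1))%R.
  - apply Rmult_le_compat_r; [lra|apply Rmin_r].
  - right; field; lra. }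
assert (H1 := Rle_abs k); nra.
Qed.

Lemma pow_small (q e : R) : (0 < q < 1)%R -> (0 < e)%R -> exists m, (q ^ m < e)%R.
Proof.
intros Hq He.
destruct (pow_lt_1_zero q ltac:(rewrite Rabs_pos_eq; lra) e He) as [m Hm].
exists m; specialize (Hm m (le_n m)).
rewrite Rabs_pos_eq in Hm; [easy|apply pow_le; lra].
Qed.

(** Shrink the circle through the scales [1, q, q ^ 2, ...]. The step costs carry factors
    [q ^ m (1 - q)], which add up to less than 1, and at small scales the sum itself vanishes by the
    Lipschitz bound. Letting [q] tend to 1 removes the term [2 (1 - q)]. *)
Lemma cauchy_sum_le g (rho M1 M2 : R) om z N :
  bounded_differences g rho M1 M2 -> (0 <= M1)%R -> (0 <= M2)%R -> (rho <= 1)%R ->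
  (Cmod z < rho)%R -> primitive_root N om -> (1 < N)%nat ->
  (Cmod (cauchy_sum g rho om z N 1) <= INR N * (M2 * Cmod (om - 1)))%R.
Proof.
intros Hg HM1 HM2 Hrho Hz Hom HN.
assert (Hrho0 := Cmod_ge_0 z); assert (HN0 := pos_INR N).
assert (Hd := Cmod_ge_0 (om - 1)).
apply (Rle_of_eps _ _ (INR N * (M2 * 2))); intros p Hp.
set (q := (1 - p)%R).
set (K := (2 * (1 - q) + Cmod (om - 1))%R).
assert (Hq : (0 < q < 1)%R) by (unfold q; lra).
replace (INR N * (M2 * Cmod (om - 1)) + INR N * (M2 * 2) * p)%R
  with (INR N * M2 * K)%R by (unfold K, q; ring).
set (E := cauchy_sum g rho om z N).
assert (Hpow : forall m, (0 < q ^ m <= 1)%R).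
{ intros m; split; [apply pow_lt; lra|].
  rewrite <- (pow1 m); apply pow_incr; lra. }
assert (H1 : forall m,
  (Cmod (E 1%R - E (q ^ m)%R) <= INR N * M2 * K * (1 - q ^ m))%R).
{ induction m as [|m IH].
  - simpl; replace (E 1%R - E 1%R) with (RtoC 0) by ring; rewrite Cmod_0; lra.
  - replace (E 1%R - E (q ^ S m)%R)
      with ((E 1%R - E (q ^ m)%R) + - (E (q ^ m * q)%R - E (q ^ m)%R))
      by (simpl; rewrite (Rmult_comm q); ring).
    eapply Rle_trans; [apply Cmod_triangle|]; rewrite Cmod_opp.
    eapply Rle_trans; [apply Rplus_le_compat; [exact IH|]|].
    + apply (cauchy_sum_step g rho M1 M2); try easy; apply Hpow.
    + fold K; right; simpl; ring. }
(* The increment of [g] is at most [M1 q ^ m |w - z|], which cancels the denominator of the weight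
   [w / (w - z)]. *)
assert (H2 : forall m, (Cmod (E (q ^ m)%R) <= INR N * (M1 * q ^ m))%R).
{ intros m; apply csum_mod_le; intros j _; set (w := rho * om ^ j).
  assert (Hw : Cmod w = rho) by (apply (Cmod_circle N); [easy|lra]).
  assert (Hwz : w - z <> 0) by (apply Cminus_neq_0; intros Ez; rewrite Ez in Hw; lra).
  assert (Hwp : (0 < Cmod (w - z))%R) by now apply Cmod_gt_0.
  rewrite Cmod_mult, Cmod_div, Hw by easy.
  specialize (Hpow m).
  eapply Rle_trans.
  - apply Rmult_le_compat_r; [apply Rdiv_le_0_compat; lra|].
    apply (bdd_lip _ _ _ _ Hg); [apply Cmod_convex; lra|lra].
  - replace (z + RtoC (q ^ m) * (w - z) - z) with (RtoC (q ^ m) * (w - z)) by ring.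
    rewrite Cmod_mult, Cmod_R, Rabs_pos_eq by lra.
    replace (M1 * (q ^ m * Cmod (w - z)) * (rho / Cmod (w - z)))%R
      with (M1 * q ^ m * rho)%R by (field; lra).
    rewrite <- (Rmult_1_r (M1 * q ^ m)) at 2.
    apply Rmult_le_compat_l; nra. }
apply (Rle_of_eps _ _ (INR N * M1)); intros e He.
destruct (pow_small q e Hq ltac:(lra)) as [m Hm].
replace (E 1%R) with ((E 1%R - E (q ^ m)%R) + E (q ^ m)%R) by ring.
eapply Rle_trans; [apply Cmod_triangle|].
apply Rplus_le_compat.
- eapply Rle_trans; [apply H1|].
  rewrite <- (Rmult_1_r (INR N * M2 * K)) at 2.
  apply Rmult_le_compat_l; [|destruct (Hpow m); lra].
  repeat apply Rmult_le_pos; unfold K; lra.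
- eapply Rle_trans; [apply H2|]; rewrite Rmult_assoc.
  apply Rmult_le_compat_l; [lra|]; apply Rmult_le_compat_l; lra.
Qed.

(** * Power series expansion in a disc *)

(** This is the trapezoidal rule for the Cauchy integral of the [k]-th Taylor coefficient. *)
Definition dft (g : C -> C) (rho : R) (om : C) (N k : nat) : C :=
  / INR N * csum N (fun j => g (rho * om ^ j) * (/ (rho * om ^ j)) ^ k).

Lemma INR_C_neq_0 N : (0 < N)%nat -> RtoC (INR N) <> 0.
Proof.
intros HN; apply Cmod_neq_0; apply lt_0_INR in HN.
rewrite Cmod_R, Rabs_pos_eq; lra.
Qed.

Lemma dft_mod_le g (rho : R) om N k :
  (forall w, (Cmod w <= rho)%R -> (Cmod (g w) <= 1)%R) -> (0 < rho)%R ->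
  primitive_root N om -> (Cmod (dft g rho om N k) <= (/ rho) ^ k)%R.
Proof.
intros Hg Hrho Hom; unfold dft.
assert (HN := prim_pos _ _ Hom); assert (HN' := lt_0_INR _ HN).
rewrite Cmod_mult, Cmod_inv, Cmod_R, Rabs_pos_eq by (now apply INR_C_neq_0 || lra).
apply Rmult_le_reg_l with (INR N); [lra|].
rewrite <- Rmult_assoc, Rinv_r, Rmult_1_l by lra.
apply csum_mod_le; intros j _.
assert (Hw := Cmod_circle N rho om j Hom (Rlt_le _ _ Hrho)).
rewrite Cmod_mult, Cmod_pow, Cmod_inv, Hw by (apply Cmod_neq_0; lra).
rewrite <- (Rmult_1_l ((/ rho) ^ k)) at 2.
apply Rmult_le_compat_r; [|apply Hg; lra].
apply pow_le; left; now apply Rinv_0_lt_compat.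
Qed.

(** At every node [w] one has [w ^ N = rho ^ N], so summing [(z / w) ^ k] over [k < N] gives the
    Cauchy kernel [w / (w - z)] times the common factor [1 - (z / rho) ^ N]. The identity is thus
    exact for every [g]. *)
Lemma dft_interpolation g (rho : R) om N z :
  (Cmod z < rho)%R -> primitive_root N om ->
  csum N (fun k => z ^ k * dft g rho om N k) - g z
  = (1 - (z / rho) ^ N) * (/ INR N * cauchy_sum g rho om z N 1).
Proof.
intros Hz Hom.
assert (Hrho0 := Cmod_ge_0 z).
assert (HN := prim_pos _ _ Hom); assert (HN' := INR_C_neq_0 _ HN).
assert (Ho := primitive_root_neq_0 _ _ Hom).
assert (Hr : RtoC rho <> 0) by (apply Cmod_neq_0; rewrite Cmod_R, Rabs_pos_eq; lra).
set (w := fun j => rho * om ^ j).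
assert (Hw : forall j, w j <> 0).
{ intros j; apply Cmult_neq_0; [easy|now apply Cpow_nz]. }
assert (Hwz : forall j, w j - z <> 0).
{ intros j; apply Cminus_neq_0; intros E.
  assert (Hm := Cmod_circle N rho om j Hom ltac:(lra)); fold (w j) in Hm.
  rewrite E in Hm; lra. }
assert (Hgeom : forall j, csum N (fun k => (z * / w j) ^ k)
                          = (1 - (z / rho) ^ N) * (w j / (w j - z))).
{ intros j.
  replace ((z / rho) ^ N) with ((z * / w j) ^ N).
  - rewrite <- csum_geom; field; split; [apply Hwz|apply Hw].
  - replace (z * / w j) with (z / rho * / om ^ j)
      by (unfold w; field; split; [now apply Cpow_nz|easy]).
    rewrite Cpow_mult_l, <- Cpow_inv, <- Cpow_mult_r, Nat.mul_comm by easy.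
    rewrite Cpow_mult_r, Cpow_inv, (prim_pow _ _ Hom), Cinv_one, Cpow_1_l by easy.
    ring. }
(* The case of the constant function 1: by orthogonality only [k = 0] survives. It allows [g z] to
   be moved under the sum over the nodes. *)
assert (H1 : csum N (fun j => csum N (fun k => (z * / w j) ^ k)) = INR N).
{ rewrite csum_exchange.
  rewrite (csum_single _ O); [|easy|].
  - rewrite (csum_ext _ _ (fun _ => 1)) by easy; rewrite csum_const; ring.
  - intros k Hk Hk0.
    rewrite (csum_ext _ _
      (fun j => (z / rho) ^ k * ((om ^ j) ^ 0 * (/ om ^ j) ^ k))).
    + rewrite csum_scal, root_orthogonality by easy.
      destruct (Nat.eq_dec 0 k) as [E|_]; [lia|ring].
    + intros j _; simpl (_ ^ 0); rewrite Cmult_1_l, <- Cpow_mult_l; f_equal.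
      unfold w; field; split; [now apply Cpow_nz|easy]. }
unfold cauchy_sum.
replace (csum N (fun k => z ^ k * dft g rho om N k)) with
  (/ INR N * csum N (fun j => g (w j) * csum N (fun k => (z * / w j) ^ k))).
- transitivity (/ INR N * (csum N (fun j => g (w j) * csum N (fun k => (z * / w j) ^ k))
      - g z * csum N (fun j => csum N (fun k => (z * / w j) ^ k)))).
  { rewrite H1; field; easy. }
  rewrite <- csum_scal, <- csum_minus.
  replace ((1 - (z / rho) ^ N) * (/ INR N * csum N (fun j =>
      (g (z + 1%R * (rho * om ^ j - z)) - g z) * (rho * om ^ j / (rho * om ^ j - z)))))
    with (/ INR N * ((1 - (z / rho) ^ N) * csum N (fun j =>
      (g (z + 1%R * (rho * om ^ j - z)) - g z) * (rho * om ^ j / (rho * om ^ j - z)))))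
    by ring.
  f_equal; rewrite <- csum_scal; apply csum_ext; intros j _.
  rewrite Hgeom; fold (w j).
  replace (z + 1%R * (w j - z)) with (w j) by ring; ring.
- rewrite <- csum_scal.
  rewrite (csum_ext N _ (fun j => csum N (fun k => / INR N * (g (w j) * (z * / w j) ^ k)))).
  + rewrite csum_exchange; apply csum_ext; intros k _; unfold dft.
    rewrite !csum_scal.
    rewrite (csum_ext N _ (fun j => z ^ k * (g (w j) * (/ w j) ^ k))).
    * rewrite csum_scal; unfold w; ring.
    * intros j _; rewrite Cpow_mult_l; ring.
  + intros j _; now rewrite !csum_scal.
Qed.

Lemma dft_approximation g (rho M1 M2 : R) om N z :
  bounded_differences g rho M1 M2 -> (0 <= M1)%R -> (0 <= M2)%R -> (rho <= 1)%R ->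
  (Cmod z < rho)%R -> primitive_root N om -> (1 < N)%nat ->
  (Cmod (csum N (fun k => z ^ k * dft g rho om N k) - g z)%C
   <= 2 * (M2 * Cmod (om - 1)))%R.
Proof.
intros Hg HM1 HM2 Hrho Hz Hom HN.
assert (Hrho0 := Cmod_ge_0 z).
assert (HN' := lt_0_INR N ltac:(lia)).
assert (Hr : RtoC rho <> 0) by (apply Cmod_neq_0; rewrite Cmod_R, Rabs_pos_eq; lra).
rewrite dft_interpolation by easy.
rewrite !Cmod_mult, Cmod_inv, Cmod_R, Rabs_pos_eq by (apply INR_C_neq_0; lia) || lra.
assert (H1 := cauchy_sum_le g rho M1 M2 om z N Hg HM1 HM2 Hrho Hz Hom HN).
assert (H2 : (Cmod (1 - (z / rho) ^ N) <= 2)%R).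
{ eapply Rle_trans; [apply Cmod_triangle|].
  rewrite Cmod_1, Cmod_opp, Cmod_pow, Cmod_div, Cmod_R, Rabs_pos_eq by easy || lra.
  assert ((Cmod z / rho) ^ N <= 1)%R; [|lra].
  rewrite <- (pow1 N); apply pow_incr; split.
  - apply Rdiv_le_0_compat; lra.
  - apply Rmult_le_reg_r with rho; [lra|].
    unfold Rdiv; rewrite Rmult_assoc, Rinv_l; lra. }
apply Rmult_le_compat; [apply Cmod_ge_0| |easy|].
- apply Rmult_le_pos; [left; now apply Rinv_0_lt_compat|apply Cmod_ge_0].
- apply Rmult_le_reg_l with (INR N); [lra|].
  rewrite <- Rmult_assoc, Rinv_r, Rmult_1_l by lra; exact H1.
Qed.

(** Cauchy's estimate for a polynomial of degree below [L]: averaging over [L] equally spaced points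
    extracts each coefficient exactly. *)
Lemma coef_mod_le (d : nat -> C) L (r eps : R) k :
  (0 < r)%R ->
  (forall z, Cmod z = r -> (Cmod (csum L (fun k => z ^ k * d k))%C <= eps)%R) ->
  (k < L)%nat -> (Cmod (d k) <= eps * (/ r) ^ k)%R.
Proof.
intros Hr Hd Hk.
assert (HL := lt_0_INR L ltac:(lia)).
assert (Hom := primitive_root_cis L ltac:(lia)).
set (om := cis (2 * PI / INR L)) in Hom.
assert (Ho := primitive_root_neq_0 _ _ Hom).
assert (Hsum : csum L (fun j => (/ om ^ j) ^ k
                   * csum L (fun l => (r * om ^ j) ^ l * d l))
               = INR L * (r ^ k * d k)).
{ rewrite (csum_ext _ _ (fun j => csum L (fun l =>
    (r ^ l * d l) * ((om ^ j) ^ l * (/ om ^ j) ^ k)))).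
  - rewrite csum_exchange, (csum_single _ k); [|easy|].
    + rewrite csum_scal, root_orthogonality by easy.
      destruct (Nat.eq_dec k k); [ring|lia].
    + intros l Hl Hlk; rewrite csum_scal, root_orthogonality by easy.
      destruct (Nat.eq_dec l k); [lia|ring].
  - intros j _; rewrite <- csum_scal; apply csum_ext; intros l _.
    rewrite Cpow_mult_l; ring. }
assert (Hle : (Cmod (INR L * (r ^ k * d k)) <= INR L * eps)%R).
{ rewrite <- Hsum; apply csum_mod_le; intros j _.
  rewrite Cmod_mult, Cmod_pow, Cmod_inv, Cmod_pow, (prim_mod _ _ Hom) by now apply Cpow_nz.
  rewrite pow1, Rinv_1, pow1, Rmult_1_l; apply Hd.
  apply (Cmod_circle L); [easy|lra]. }
rewrite !Cmod_mult, Cmod_pow, !Cmod_R, !Rabs_pos_eq in Hle by lra.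
apply Rmult_le_reg_l in Hle; [|easy].
assert (Hrk := pow_lt r k Hr).
apply Rmult_le_reg_l with (r ^ k)%R; [easy|].
rewrite pow_inv.
replace (r ^ k * (eps * / r ^ k))%R with eps by (field; lra); exact Hle.
Qed.

Lemma INR_S_inv_small (e K : R) :
  (0 < e)%R -> exists n0, forall n, (n0 <= n)%nat -> (K * / INR (S n) <= e)%R.
Proof.
intros He.
destruct (nfloor_ex (Rabs K / e)) as [n0 [_ Hn0]].
{ apply Rdiv_le_0_compat; [apply Rabs_pos|easy]. }
exists n0; intros n Hn.
assert (Hn1 := lt_0_INR (S n) ltac:(lia)).
assert (Hn2 := le_INR _ _ Hn).
apply Rmult_le_reg_r with (INR (S n)); [easy|].
rewrite Rmult_assoc, Rinv_l, Rmult_1_r by lra.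
rewrite S_INR.
assert (H1 := Rle_abs K).
apply Rmult_lt_compat_r with (r := e) in Hn0; [|easy].
unfold Rdiv in Hn0; rewrite Rmult_assoc, Rinv_l, Rmult_1_r in Hn0 by lra.
assert ((INR n0 + 1) * e <= (INR n + 1) * e)%R by (apply Rmult_le_compat_r; lra).
lra.
Qed.

(** The limit is given in a sigma type, so that the limits of all coefficients can later be
    collected into one sequence by projection. *)
Lemma real_limit_rate (u : nat -> R) (K : R) :
  (forall n m, (Rabs (u n - u m) <= K * (/ INR (S n) + / INR (S m)))%R) ->
  {l | forall n, (Rabs (u n - l) <= K * / INR (S n))%R}.
Proof.
intros Hu.
assert (Hc : Cauchy_crit u).
{ intros e He.
  destruct (INR_S_inv_small (e / 3) K ltac:(lra)) as [n0 Hn0].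
  exists n0; intros n m Hn Hm; unfold Rdist.
  assert (H1 := Hn0 n Hn); assert (H2 := Hn0 m Hm); specialize (Hu n m); lra. }
destruct (Rcomplete.R_complete u Hc) as [l Hl].
exists l; intros n; apply le_epsilon; intros e He.
destruct (Hl (e / 2)%R ltac:(lra)) as [n1 Hn1].
destruct (INR_S_inv_small (e / 2) K ltac:(lra)) as [n2 Hn2].
set (m := Nat.max n1 n2).
specialize (Hn1 m ltac:(lia)); specialize (Hn2 m ltac:(lia)); unfold Rdist in Hn1.
replace (u n - l)%R with ((u n - u m) + (u m - l))%R by ring.
eapply Rle_trans; [apply Rabs_triang|].
specialize (Hu n m); lra.
Qed.

Lemma im_le_Cmod (z : C) : (Rabs (Im z) <= Cmod z)%R.
Proof. eapply Rle_trans; [apply Rmax_r|apply Rmax_Cmod]. Qed.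

Lemma Cmod_le_Re_Im (z : C) : (Cmod z <= Rabs (Re z) + Rabs (Im z))%R.
Proof.
assert (H1 := Rabs_pos (Re z)); assert (H2 := Rabs_pos (Im z)).
apply Rsqr_incr_0_var; [|lra].
rewrite Rsqr_pow2, Cmod2_alt, <- (pow2_abs (Re z)), <- (pow2_abs (Im z)).
unfold Rsqr; nra.
Qed.

Lemma complex_limit_rate (u : nat -> C) (K : R) :
  (forall n m, (Cmod (u n - u m) <= K * (/ INR (S n) + / INR (S m)))%R) ->
  {l : C | forall n, (Cmod (u n - l) <= 2 * K * / INR (S n))%R}.
Proof.
intros Hu.
destruct (real_limit_rate (fun n => Re (u n)) K) as [x Hx].
{ intros n m; eapply Rle_trans; [|apply Hu].
  apply (re_le_Cmod (u n - u m)). }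
destruct (real_limit_rate (fun n => Im (u n)) K) as [y Hy].
{ intros n m; eapply Rle_trans; [|apply Hu].
  apply (im_le_Cmod (u n - u m)). }
exists (x, y); intros n.
eapply Rle_trans; [apply Cmod_le_Re_Im|].
specialize (Hx n); specialize (Hy n).
change (Re (u n - (x, y))) with (Re (u n) - x)%R.
change (Im (u n - (x, y))) with (Im (u n) - y)%R; lra.
Qed.

(** The coefficients are limits of the discrete ones as the number of nodes grows. The polynomials
    approximate the same [g] uniformly, so Cauchy's estimate makes each coefficient a Cauchy
    sequence. *)
Lemma complex_power_series g (rho M1 M2 : R) :
  bounded_differences g rho M1 M2 -> (0 <= M1)%R -> (0 <= M2)%R -> (0 < rho <= 1)%R ->
  (forall w, (Cmod w <= rho)%R -> (Cmod (g w) <= 1)%R) ->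
  exists c : nat -> C,
    (forall k, (Cmod (c k) <= (/ rho) ^ k)%R) /\
    forall z, (Cmod z < rho)%R -> forall K,
      (Cmod (csum K (fun k => z ^ k * c k) - g z)%C
       <= (Cmod z / rho) ^ K / (1 - Cmod z / rho))%R.
Proof.
intros Hg HM1 HM2 Hrho Hg1.
assert (Hpi := PI_RGT_0).
set (om := fun n => cis (2 * PI / INR (S (S n)))).
assert (Hom : forall n, primitive_root (S (S n)) (om n))
  by (intros n; apply primitive_root_cis; lia).
(* There are [n + 2] nodes because the approximation needs at least two; padding with zeros lets
   polynomials of different degrees be subtracted. *)
set (a := fun n k => if Nat.ltb k (S (S n)) then dft g rho (om n) (S (S n)) k else 0).
(* [B] comes from the error [2 M2 |om - 1|] and the chord bound [|om - 1| <= 2 PI / (n + 2)]. *)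
set (B := (4 * PI * M2)%R).
assert (Ha1 : forall n k, (Cmod (a n k) <= (/ rho) ^ k)%R).
{ intros n k; unfold a; destruct (Nat.ltb k (S (S n))).
  - now apply dft_mod_le.
  - rewrite Cmod_0; apply pow_le; left; now apply Rinv_0_lt_compat. }
assert (Ha2 : forall n z L, (Cmod z < rho)%R -> (S (S n) <= L)%nat ->
  (Cmod (csum L (fun k => z ^ k * a n k) - g z)%C <= B * / INR (S n))%R).
{ intros n z L Hz HL.
  rewrite (csum_pad (S (S n)) L); [|easy|].
  2:{ intros k Hk; unfold a; apply Nat.ltb_ge in Hk; rewrite Hk; ring. }
  rewrite (csum_ext _ _ (fun k => z ^ k * dft g rho (om n) (S (S n)) k)).
  2:{ intros k Hk; unfold a; apply Nat.ltb_lt in Hk; now rewrite Hk. }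
  eapply Rle_trans.
  - apply (dft_approximation g rho M1 M2); try easy; lia.
  - unfold B; assert (Hn := lt_0_INR (S n) ltac:(lia)).
    assert (Hn' : (INR (S n) <= INR (S (S n)))%R) by (apply le_INR; lia).
    assert (Hd : (Cmod (om n - 1) <= 2 * PI * / INR (S n))%R).
    { eapply Rle_trans; [apply cis_sub_1_mod, Rdiv_lt_0_compat; lra|].
      apply Rmult_le_compat_l; [lra|]; now apply Rinv_le_contravar. }
    apply Rmult_le_compat_l with (r := (2 * M2)%R) in Hd; lra. }
(* Cauchy's estimate is applied on the circle of radius [rho / 2], as the approximation is available
   only strictly inside radius [rho]. *)
assert (Hc : forall k, {l : C | forall n,
  (Cmod (a n k - l) <= 2 * (B * (/ (rho / 2)) ^ k) * / INR (S n))%R}).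
{ intros k; apply complex_limit_rate; intros n m.
  set (L := (S (S n) + S (S m) + S k)%nat).
  replace (B * (/ (rho / 2)) ^ k * (/ INR (S n) + / INR (S m)))%R
    with ((B * / INR (S n) + B * / INR (S m)) * (/ (rho / 2)) ^ k)%R by ring.
  apply (coef_mod_le (fun k => a n k - a m k) L); [lra| |unfold L; lia].
  intros z Hz.
  rewrite (csum_ext _ _ (fun k => z ^ k * a n k - z ^ k * a m k))
    by (intros l _; ring).
  rewrite csum_minus.
  replace (csum L (fun k => z ^ k * a n k) - csum L (fun k => z ^ k * a m k))
    with ((csum L (fun k => z ^ k * a n k) - g z)
          + - (csum L (fun k => z ^ k * a m k) - g z)) by ring.
  eapply Rle_trans; [apply Cmod_triangle|]; rewrite Cmod_opp.
  apply Rplus_le_compat; apply Ha2; unfold L; lra || lia. }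
set (c := fun k => proj1_sig (Hc k)).
assert (Hlim : forall z K, exists D, forall n,
  (Cmod (csum K (fun k => z ^ k * c k) - csum K (fun k => z ^ k * a n k))%C
   <= D * / INR (S n))%R).
{ intros z K; induction K as [|K [D HD]].
  - exists 0%R; intros n; simpl; replace (0 - 0) with (RtoC 0) by ring.
    rewrite Cmod_0; lra.
  - exists (D + Cmod z ^ K * (2 * (B * (/ (rho / 2)) ^ K)))%R; intros n; simpl csum.
    replace (csum K (fun k => z ^ k * c k) + z ^ K * c K
             - (csum K (fun k => z ^ k * a n k) + z ^ K * a n K))
      with ((csum K (fun k => z ^ k * c k) - csum K (fun k => z ^ k * a n k))
            + - (z ^ K * (a n K - c K))) by ring.
    eapply Rle_trans; [apply Cmod_triangle|].
    rewrite Cmod_opp, Cmod_mult, Cmod_pow, Rmult_plus_distr_r.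
    apply Rplus_le_compat; [apply HD|].
    rewrite Rmult_assoc; apply Rmult_le_compat_l; [apply pow_le, Cmod_ge_0|].
    apply (proj2_sig (Hc K) n). }
exists c; split.
- intros k; apply le_epsilon; intros e He.
  destruct (INR_S_inv_small e (2 * (B * (/ (rho / 2)) ^ k)) He) as [n Hn].
  specialize (Hn n (le_n n)).
  replace (c k) with (a n k + - (a n k - c k)) by ring.
  eapply Rle_trans; [apply Cmod_triangle|]; rewrite Cmod_opp.
  apply Rplus_le_compat; [apply Ha1|].
  eapply Rle_trans; [apply (proj2_sig (Hc k) n)|exact Hn].
- intros z Hz K; apply le_epsilon; intros e He.
  set (tau := (Cmod z / rho)%R).
  assert (Htau : (0 <= tau < 1)%R).
  { assert (H0 := Cmod_ge_0 z); unfold tau; split.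
    - apply Rdiv_le_0_compat; lra.
    - apply Rmult_lt_reg_r with rho; [lra|].
      unfold Rdiv; rewrite Rmult_assoc, Rinv_l; lra. }
  destruct (Hlim z K) as [D HD].
  destruct (INR_S_inv_small e (D + B) He) as [n Hn].
  specialize (Hn n (le_n n)); rewrite Rmult_plus_distr_r in Hn.
  specialize (HD n).
  set (L := (S (S n) + K)%nat).
  assert (H1 := Ha2 n z L Hz ltac:(unfold L; lia)).
  assert (H2 : (Cmod (csum L (fun k => z ^ k * a n k) - csum K (fun k => z ^ k * a n k))%C
                <= (tau ^ K - tau ^ L) / (1 - tau))%R).
  { apply csum_tail_le; [easy|unfold L; lia|]; intros k.
    unfold tau, Rdiv; rewrite Cmod_mult, Cmod_pow, Rpow_mult_distr.
    apply Rmult_le_compat_l; [apply pow_le, Cmod_ge_0|apply Ha1]. }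
  assert (H3 : ((tau ^ K - tau ^ L) / (1 - tau) <= tau ^ K / (1 - tau))%R).
  { apply Rmult_le_compat_r; [left; apply Rinv_0_lt_compat; lra|].
    assert (0 <= tau ^ L)%R by (apply pow_le; lra); lra. }
  (* Three errors: passing from [c] to [a n] in the first [K] terms, the tail of [a n] from [K] to
     [L], and the approximation of [g] at level [n]. The first and the last together are at most
     [e]; the tail gives the stated bound. *)
  replace (csum K (fun k => z ^ k * c k) - g z) with
    ((csum K (fun k => z ^ k * c k) - csum K (fun k => z ^ k * a n k))
     + (- (csum L (fun k => z ^ k * a n k) - csum K (fun k => z ^ k * a n k))
        + (csum L (fun k => z ^ k * a n k) - g z))) by ring.
  eapply Rle_trans; [apply Cmod_triangle|].
  eapply Rle_trans; [apply Rplus_le_compat_l, Cmod_triangle|].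
  rewrite Cmod_opp; lra.
Qed.

Local Close Scope C_scope.

(** * Quaternions and the Pick matrix *)

Ltac hring :=
  repeat match goal with q : H |- _ => destruct q end;
  unfold Hnorm2, Hsub, Hadd, Hmul, Hopp, Hconj, Hone, Hzero; cbn [q0 q1 q2 q3];
  try apply f_equal4; ring.

Lemma Hmul_assoc (a b c : H) : Hmul a (Hmul b c) = Hmul (Hmul a b) c.
Proof. hring. Qed.

Lemma Hmul_1_l (a : H) : Hmul Hone a = a.
Proof. hring. Qed.

Lemma Hmul_1_r (a : H) : Hmul a Hone = a.
Proof. hring. Qed.

Lemma Hmul_0_l (a : H) : Hmul Hzero a = Hzero.
Proof. hring. Qed.

Lemma Hadd_0_r (a : H) : Hadd a Hzero = a.
Proof. hring. Qed.

Lemma Hmul_add_l (a b c : H) : Hmul (Hadd a b) c = Hadd (Hmul a c) (Hmul b c).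
Proof. hring. Qed.

Lemma Hconj_mul (a b : H) : Hconj (Hmul a b) = Hmul (Hconj b) (Hconj a).
Proof. hring. Qed.

Lemma Hconj_conj (a : H) : Hconj (Hconj a) = a.
Proof. hring. Qed.

Lemma Hmul_conj_r (a : H) : Hmul a (Hconj a) = mkH (Hnorm2 a) 0 0 0.
Proof. hring. Qed.

Lemma Hmul_conj_l (a : H) : Hmul (Hconj a) a = mkH (Hnorm2 a) 0 0 0.
Proof. hring. Qed.

Lemma Hnorm2_mul (a b : H) : Hnorm2 (Hmul a b) = Hnorm2 a * Hnorm2 b.
Proof. hring. Qed.

Lemma Hnorm2_conj (a : H) : Hnorm2 (Hconj a) = Hnorm2 a.
Proof. hring. Qed.

Lemma Hnorm2_pos (a : H) : 0 <= Hnorm2 a.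
Proof. unfold Hnorm2; nra. Qed.

Lemma Hnorm_pos (a : H) : 0 <= Hnorm a.
Proof. apply sqrt_pos. Qed.

Lemma Hnorm_sqr (a : H) : Hnorm a ^ 2 = Hnorm2 a.
Proof. apply pow2_sqrt, Hnorm2_pos. Qed.

Lemma Hnorm_mul (a b : H) : Hnorm (Hmul a b) = Hnorm a * Hnorm b.
Proof. unfold Hnorm; rewrite Hnorm2_mul; apply sqrt_mult; apply Hnorm2_pos. Qed.

Lemma Hnorm_conj (a : H) : Hnorm (Hconj a) = Hnorm a.
Proof. unfold Hnorm; now rewrite Hnorm2_conj. Qed.

Lemma Hnorm_one : Hnorm Hone = 1.
Proof.
unfold Hnorm; replace (Hnorm2 Hone) with 1 by hring; apply sqrt_1.
Qed.

Lemma Hnorm_pow (a : H) n : Hnorm (Hpow a n) = Hnorm a ^ n.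
Proof.
induction n as [|n IH]; simpl; [apply Hnorm_one|now rewrite Hnorm_mul, IH].
Qed.

Lemma Hnorm_le_of_sqr (a : H) (b : R) : 0 <= b -> Hnorm2 a <= b ^ 2 -> Hnorm a <= b.
Proof.
intros Hb Hab; rewrite <- Hnorm_sqr in Hab.
assert (Ha := Hnorm_pos a); nra.
Qed.

Lemma Hcomp_le_norm (a : H) :
  Rabs (q0 a) <= Hnorm a /\ Rabs (q1 a) <= Hnorm a /\
  Rabs (q2 a) <= Hnorm a /\ Rabs (q3 a) <= Hnorm a.
Proof.
unfold Hnorm, Hnorm2.
repeat split; rewrite <- sqrt_Rsqr_abs; apply sqrt_le_1_alt; unfold Rsqr; nra.
Qed.

Lemma Hpow_comm (a : H) n : Hmul a (Hpow a n) = Hmul (Hpow a n) a.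
Proof.
induction n as [|n IH]; simpl.
- now rewrite Hmul_1_l, Hmul_1_r.
- now rewrite IH at 1; rewrite Hmul_assoc.
Qed.

Lemma Hpow_conj (a : H) n : Hpow (Hconj a) n = Hconj (Hpow a n).
Proof.
induction n as [|n IH]; simpl; [hring|].
now rewrite IH, <- Hconj_mul, Hpow_comm.
Qed.

Lemma Hsum_ext n (a b : nat -> H) :
  (forall k, (k < n)%nat -> a k = b k) -> Hsum n a = Hsum n b.
Proof.
induction n as [|n IH]; intros Hab; simpl; [easy|].
rewrite IH, Hab; [easy|lia|]; intros k Hk; apply Hab; lia.
Qed.

Lemma Hsum_sub n (a b : nat -> H) :
  Hsum n (fun k => Hsub (a k) (b k)) = Hsub (Hsum n a) (Hsum n b).
Proof. induction n as [|n IH]; simpl; [|rewrite IH]; hring. Qed.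

Lemma Hsum_mul_l n (c : H) (a : nat -> H) :
  Hsum n (fun k => Hmul c (a k)) = Hmul c (Hsum n a).
Proof. induction n as [|n IH]; simpl; [|rewrite IH]; hring. Qed.

Lemma Hsum_mul_r n (c : H) (a : nat -> H) :
  Hsum n (fun k => Hmul (a k) c) = Hmul (Hsum n a) c.
Proof. induction n as [|n IH]; simpl; [|rewrite IH]; hring. Qed.

Lemma Hsum_conj n (a : nat -> H) : Hsum n (fun k => Hconj (a k)) = Hconj (Hsum n a).
Proof. induction n as [|n IH]; simpl; [|rewrite IH]; hring. Qed.

Lemma Hsum_mul_conj n (a b : nat -> H) :
  Hsum n (fun i => Hsum n (fun j => Hmul (a i) (Hconj (b j))))
  = Hmul (Hsum n a) (Hconj (Hsum n b)).
Proof.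
rewrite <- Hsum_mul_r; apply Hsum_ext; intros i _.
now rewrite Hsum_mul_l, Hsum_conj.
Qed.

(** * Convergent series of quaternions *)

Lemma infinite_sum_ext (a b : nat -> R) (l : R) :
  (forall k, a k = b k) -> infinite_sum a l -> infinite_sum b l.
Proof.
intros Hab Ha; apply is_series_Reals; apply is_series_Reals in Ha.
exact (is_series_ext _ _ _ Hab Ha).
Qed.

Lemma infinite_sum_plus (a b : nat -> R) (l m : R) :
  infinite_sum a l -> infinite_sum b m ->
  infinite_sum (fun k => a k + b k) (l + m).
Proof.
intros Ha Hb; apply is_series_Reals; apply is_series_Reals in Ha, Hb.
exact (is_series_plus _ _ _ _ Ha Hb).
Qed.

Lemma infinite_sum_scal (c : R) (a : nat -> R) (l : R) :
  infinite_sum a l -> infinite_sum (fun k => c * a k) (c * l).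
Proof.
intros Ha; apply is_series_Reals; apply is_series_Reals in Ha.
exact (is_series_scal_l c _ _ Ha).
Qed.

(** Each component of a product with a constant quaternion is a fixed linear combination of the four
    components of the other factor. *)
Lemma infinite_sum_lin4 (c0 c1 c2 c3 : R) (a0 a1 a2 a3 a : nat -> R) (l0 l1 l2 l3 l : R) :
  infinite_sum a0 l0 -> infinite_sum a1 l1 ->
  infinite_sum a2 l2 -> infinite_sum a3 l3 ->
  (forall k, c0 * a0 k + c1 * a1 k + c2 * a2 k + c3 * a3 k = a k) ->
  c0 * l0 + c1 * l1 + c2 * l2 + c3 * l3 = l ->
  infinite_sum a l.
Proof.
intros H0 H1 H2 H3 Ha <-.
apply (infinite_sum_ext _ _ _ Ha).
repeat apply infinite_sum_plus; now apply infinite_sum_scal.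
Qed.

Lemma Hseries_ext (a b : nat -> H) (s : H) :
  (forall k, a k = b k) -> Hseries a s -> Hseries b s.
Proof.
intros Hab (H0 & H1 & H2 & H3).
repeat split; eapply infinite_sum_ext; try eassumption; intros k; simpl; now rewrite Hab.
Qed.

Lemma Hseries_add (a b : nat -> H) (s t : H) :
  Hseries a s -> Hseries b t -> Hseries (fun k => Hadd (a k) (b k)) (Hadd s t).
Proof.
intros (H0 & H1 & H2 & H3) (K0 & K1 & K2 & K3).
repeat split; simpl; now apply infinite_sum_plus.
Qed.

Lemma Hseries_mul_l (c : H) (a : nat -> H) (s : H) :
  Hseries a s -> Hseries (fun k => Hmul c (a k)) (Hmul c s).
Proof.
intros (H0 & H1 & H2 & H3).
repeat split; simpl.
- apply (infinite_sum_lin4 (q0 c) (- q1 c) (- q2 c) (- q3 c) _ _ _ _ _ _ _ _ _ _ H0 H1 H2 H3);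
    intros; ring.
- apply (infinite_sum_lin4 (q1 c) (q0 c) (- q3 c) (q2 c) _ _ _ _ _ _ _ _ _ _ H0 H1 H2 H3);
    intros; ring.
- apply (infinite_sum_lin4 (q2 c) (q3 c) (q0 c) (- q1 c) _ _ _ _ _ _ _ _ _ _ H0 H1 H2 H3);
    intros; ring.
- apply (infinite_sum_lin4 (q3 c) (- q2 c) (q1 c) (q0 c) _ _ _ _ _ _ _ _ _ _ H0 H1 H2 H3);
    intros; ring.
Qed.

Lemma Hseries_conj (a : nat -> H) (s : H) :
  Hseries a s -> Hseries (fun k => Hconj (a k)) (Hconj s).
Proof.
intros (H0 & H1 & H2 & H3).
assert (Hopp : forall b l, infinite_sum b l -> infinite_sum (fun k => - b k) (- l)).
{ intros b l Hb; replace (- l) with (-1 * l) by ring.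
  apply (infinite_sum_ext (fun k => -1 * b k)); [intros; ring|].
  now apply infinite_sum_scal. }
repeat split; simpl; [easy|now apply Hopp..].
Qed.

Lemma Hseries_mul_r (c : H) (a : nat -> H) (s : H) :
  Hseries a s -> Hseries (fun k => Hmul (a k) c) (Hmul s c).
Proof.
intros Hs.
rewrite <- (Hconj_conj (Hmul s c)), Hconj_mul.
apply Hseries_ext with (fun k => Hconj (Hmul (Hconj c) (Hconj (a k)))).
- intros k; now rewrite <- Hconj_mul, Hconj_conj.
- now apply Hseries_conj, Hseries_mul_l, Hseries_conj.
Qed.

Lemma Hseries_sum n (a : nat -> nat -> H) (s : nat -> H) :
  (forall i, (i < n)%nat -> Hseries (a i) (s i)) ->
  Hseries (fun k => Hsum n (fun i => a i k)) (Hsum n s).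
Proof.
induction n as [|n IH]; intros Ha; simpl.
- assert (H0 : infinite_sum (fun _ => 0) 0).
  { intros e He; exists O; intros m _; rewrite sum_eq_R0 by easy.
    unfold Rdist; rewrite Rminus_0_r, Rabs_R0; lra. }
  repeat split; exact H0.
- apply Hseries_add; [apply IH; intros; apply Ha; lia|apply Ha; lia].
Qed.

Definition Hlim (a : nat -> H) : H :=
  mkH (Series (fun k => q0 (a k))) (Series (fun k => q1 (a k)))
      (Series (fun k => q2 (a k))) (Series (fun k => q3 (a k))).

Lemma infinite_sum_dominated (a b : nat -> R) :
  (forall k, Rabs (a k) <= b k) -> ex_series b -> infinite_sum a (Series a).
Proof.
intros Hab Hb; apply is_series_Reals, Series_correct.
exact (ex_series_le (a : nat -> R_NormedModule) b Hab Hb).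
Qed.

Lemma Hlim_correct (a : nat -> H) (B q : R) :
  0 <= q < 1 -> (forall k, Hnorm (a k) <= B * q ^ k) -> Hseries a (Hlim a).
Proof.
intros Hq Ha.
assert (Hb : ex_series (fun k => B * q ^ k)).
{ apply (ex_series_scal_l B (fun k => q ^ k)), ex_series_geom; rewrite Rabs_pos_eq; lra. }
repeat split; simpl;
  (apply (infinite_sum_dominated _ (fun k => B * q ^ k)); [|exact Hb]);
  intros k; destruct (Hcomp_le_norm (a k)) as (H0 & H1 & H2 & H3);
  eapply Rle_trans; eauto.
Qed.

(** * Consequences of positivity of the Pick matrix *)

Definition pick_hyp (f : H -> H) : Prop :=
  forall z : nat -> H, (forall i, (i < 3)%nat -> inB (z i)) ->
  forall P : Hmat, is_Pick_matrix f 3 z P -> Hpsd 3 P.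

Definition pick_term (f : H -> H) (z : nat -> H) (i j k : nat) : H :=
  Hmul (Hpow (z i) k)
       (Hmul (Hsub Hone (Hmul (f (z i)) (Hconj (f (z j)))))
             (Hpow (Hconj (z j)) k)).

Lemma pick_term_series (f : H -> H) (z : nat -> H) i j :
  inB (z i) -> inB (z j) ->
  Hseries (pick_term f z i j) (Hlim (pick_term f z i j)).
Proof.
intros Hi Hj; unfold inB in Hi, Hj.
assert (Hi0 := Hnorm_pos (z i)); assert (Hj0 := Hnorm_pos (z j)).
set (B := Hnorm (Hsub Hone (Hmul (f (z i)) (Hconj (f (z j)))))).
apply (Hlim_correct _ B (Hnorm (z i) * Hnorm (z j))); [nra|].
intros k; unfold pick_term; rewrite !Hnorm_mul, !Hnorm_pow, Hnorm_conj.
rewrite Rpow_mult_distr; fold B; right; ring.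
Qed.

(** The [k]-th summand of the Pick matrix is [p p^* - r r^*] with [p_i = z_i^k] and
    [r_i = z_i^k f(z_i)]. Testing against the conjugates of the [y i] puts the weights on the left
    of both columns. *)
Lemma pick_quad_term (f : H -> H) (z y : nat -> H) n k :
  q0 (Hquad n (fun i j => pick_term f z i j k) (fun i => Hconj (y i)))
  = Hnorm2 (Hsum n (fun i => Hmul (y i) (Hpow (z i) k)))
    - Hnorm2 (Hsum n (fun i => Hmul (Hmul (y i) (Hpow (z i) k)) (f (z i)))).
Proof.
set (a := fun i => Hmul (y i) (Hpow (z i) k)).
set (b := fun i => Hmul (a i) (f (z i))).
replace (Hquad n (fun i j => pick_term f z i j k) (fun i => Hconj (y i)))
  with (Hsub (Hmul (Hsum n a) (Hconj (Hsum n a)))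
             (Hmul (Hsum n b) (Hconj (Hsum n b)))).
- rewrite !Hmul_conj_r; simpl; unfold a, b, a; ring.
- rewrite <- !Hsum_mul_conj, <- Hsum_sub; unfold Hquad.
  apply Hsum_ext; intros i _; rewrite <- Hsum_sub.
  apply Hsum_ext; intros j _; unfold pick_term, b, a.
  rewrite Hpow_conj, !Hconj_mul, Hconj_conj.
  generalize (Hpow (z i) k) (Hpow (z j) k) (f (z i)) (f (z j)) (y i) (y j).
  intros zi zj fi fj yi yj.
  (* Grouping the outer factors reduces the claim to distributivity,
     [p (1 - f g) r = p r - (p f) (g r)]. *)
  transitivity (Hmul (Hmul yi zi)
    (Hmul (Hsub Hone (Hmul fi (Hconj fj))) (Hmul (Hconj zj) (Hconj yj)))).
  + generalize (Hmul yi zi) (Hmul (Hconj zj) (Hconj yj)) (Hconj fj); intros; hring.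
  + now rewrite !Hmul_assoc.
Qed.

(* The Szego-kernel form of positivity: the quadratic form of the Pick matrix
   is the difference of two squared [l^2]-norms. *)
Lemma pick_norm_series (f : H -> H) (y z : nat -> H) :
  pick_hyp f -> (forall i, (i < 3)%nat -> inB (z i)) ->
  exists Q, 0 <= Q /\
    infinite_sum (fun k =>
      Hnorm2 (Hsum 3 (fun i => Hmul (y i) (Hpow (z i) k)))
      - Hnorm2 (Hsum 3 (fun i => Hmul (Hmul (y i) (Hpow (z i) k)) (f (z i))))) Q.
Proof.
intros Hf Hz.
set (P := fun i j => Hlim (pick_term f z i j)).
assert (HP : is_Pick_matrix f 3 z P).
{ intros i j Hi Hj; apply (pick_term_series f z i j); now apply Hz. }
destruct (Hf z Hz P HP) as [_ Hpos].
exists (q0 (Hquad 3 P (fun i => Hconj (y i)))); split; [apply Hpos|].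
assert (Hs : Hseries
  (fun k => Hquad 3 (fun i j => pick_term f z i j k) (fun i => Hconj (y i)))
  (Hquad 3 P (fun i => Hconj (y i)))).
{ unfold Hquad.
  apply (Hseries_sum 3 (fun i k => Hsum 3 (fun j =>
    Hmul (Hconj (Hconj (y i))) (Hmul (pick_term f z i j k) (Hconj (y j)))))).
  intros i Hi.
  apply (Hseries_sum 3 (fun j k =>
    Hmul (Hconj (Hconj (y i))) (Hmul (pick_term f z i j k) (Hconj (y j))))).
  intros j Hj; apply Hseries_mul_l, Hseries_mul_r; now apply HP. }
destruct Hs as [Hs _].
exact (infinite_sum_ext _ _ _ (pick_quad_term f z y 3) Hs).
Qed.

Lemma infinite_sum_le_bound (a : nat -> R) (l B : R) :
  infinite_sum a l -> (forall n, sum_f_R0 a n <= B) -> l <= B.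
Proof.
intros Ha HB; apply le_epsilon; intros e He.
destruct (Ha e He) as [n Hn]; specialize (Hn n (le_n n)); specialize (HB n).
unfold Rdist in Hn; apply Rabs_def2 in Hn; lra.
Qed.

(** Of the series involving [f], only the term [k = 0] is kept; the others are nonnegative. *)
Lemma pick_norm_le (f : H -> H) (y z : nat -> H) (S : R) :
  pick_hyp f -> (forall i, (i < 3)%nat -> inB (z i)) ->
  (forall n, sum_f_R0 (fun k =>
     Hnorm2 (Hsum 3 (fun i => Hmul (y i) (Hpow (z i) k)))) n <= S) ->
  Hnorm2 (Hsum 3 (fun i => Hmul (y i) (f (z i)))) <= S.
Proof.
intros Hf Hz HS.
destruct (pick_norm_series f y z Hf Hz) as (Q & HQ & HsumQ).
set (b := fun k => Hnorm2 (Hsum 3 (fun i => Hmul (Hmul (y i) (Hpow (z i) k)) (f (z i))))).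
assert (Hb : forall n, b O <= sum_f_R0 b n).
{ induction n as [|n IH]; simpl; [lra|].
  assert (0 <= b (Datatypes.S n)) by apply Hnorm2_pos; lra. }
assert (Hb0 : b O = Hnorm2 (Hsum 3 (fun i => Hmul (y i) (f (z i))))).
{ unfold b; f_equal; apply Hsum_ext; intros i _; simpl; now rewrite Hmul_1_r. }
rewrite <- Hb0.
assert (Q <= S - b O); [|lra].
apply (infinite_sum_le_bound _ _ _ HsumQ); intros n.
rewrite minus_sum; specialize (HS n); specialize (Hb n); unfold b in *; lra.
Qed.

(** With weights [1, 0, 0] the terms are [|z|^(2k) (1 - |f z|^2)]. If [|f z| > 1], all are
    nonpositive and the first is negative, so the sum could not be nonnegative. Using the whole
    series is what yields the sharp constant 1. *)
Lemma pick_contractive (f : H -> H) (z : H) : pick_hyp f -> inB z -> Hnorm (f z) <= 1.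
Proof.
intros Hf Hz.
destruct (pick_norm_series f (fun i => match i with O => Hone | _ => Hzero end)
            (fun _ => z) Hf ltac:(intros; exact Hz)) as (Q & HQ & HsumQ).
apply Hnorm_le_of_sqr; [lra|]; rewrite pow1.
apply Rnot_lt_le; intros Hlt.
apply (Rle_not_lt _ _ HQ), Rle_lt_trans with (1 - Hnorm2 (f z)); [|lra].
assert (Ht : forall k, Hnorm2 (Hpow z k) * (1 - Hnorm2 (f z)) <= 0).
{ intros k; assert (H0 := Hnorm2_pos (Hpow z k)); nra. }
apply (infinite_sum_ext _ (fun k => Hnorm2 (Hpow z k) * (1 - Hnorm2 (f z)))) in HsumQ.
- apply (infinite_sum_le_bound _ _ _ HsumQ).
  induction n as [|n IH]; [|rewrite tech5].
  + right; simpl; replace (Hnorm2 Hone) with 1 by hring; ring.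
  + specialize (Ht (S n)); lra.
- intros k; simpl; rewrite !Hmul_0_l, !Hadd_0_r, Hmul_1_l.
  replace (Hadd Hzero (Hpow z k)) with (Hpow z k)
    by (generalize (Hpow z k); intros; hring).
  replace (Hadd Hzero (Hmul (Hpow z k) (f z))) with (Hmul (Hpow z k) (f z))
    by (generalize (Hmul (Hpow z k) (f z)); intros; hring).
  rewrite Hnorm2_mul; ring.
Qed.

(** * Slices *)

Definition emb (w : C) : H := mkH (fst w) (snd w) 0 0.

(* [q = hfst q + hsnd q * j], compatible with left multiplication by [emb]. *)
Definition hfst (q : H) : C := (q0 q, q1 q).
Definition hsnd (q : H) : C := (q2 q, q3 q).
Definition hpair (a b : C) : H := mkH (fst a) (snd a) (fst b) (snd b).

Lemma emb_mul (a b : C) : emb (a * b)%C = Hmul (emb a) (emb b).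
Proof.
destruct a, b; unfold emb, Cmult, Hmul; simpl; apply f_equal4; ring.
Qed.

Lemma emb_add (a b : C) : emb (a + b)%C = Hadd (emb a) (emb b).
Proof.
destruct a, b; unfold emb, Cplus, Hadd; simpl; apply f_equal4; ring.
Qed.

Lemma emb_one : emb 1 = Hone.
Proof. reflexivity. Qed.

Lemma Hnorm_emb (a : C) : Hnorm (emb a) = Cmod a.
Proof.
unfold Hnorm, Cmod, Hnorm2; simpl; f_equal; ring.
Qed.

Lemma hfst_mul (a : C) (q : H) : hfst (Hmul (emb a) q) = (a * hfst q)%C.
Proof. destruct a; unfold hfst, Cmult; simpl; f_equal; ring. Qed.

Lemma hsnd_mul (a : C) (q : H) : hsnd (Hmul (emb a) q) = (a * hsnd q)%C.
Proof. destruct a; unfold hsnd, Cmult; simpl; f_equal; ring. Qed.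

Lemma hpair_mul (a b c : C) : hpair (a * b)%C (a * c)%C = Hmul (emb a) (hpair b c).
Proof.
destruct a, b, c; unfold hpair, Cmult, Hmul; simpl; apply f_equal4; ring.
Qed.

Lemma Hnorm2_split (q : H) : Hnorm2 q = Cmod (hfst q) ^ 2 + Cmod (hsnd q) ^ 2.
Proof. rewrite !Cmod2_alt; unfold Hnorm2; simpl; ring. Qed.

(** For a unit [u] the conjugate is the inverse, so [rot u] is a multiplicative, norm-preserving
    embedding of the complex plane as one slice. *)
Definition rot (u : H) (w : C) : H := Hmul u (Hmul (emb w) (Hconj u)).

Lemma conj_unit_l (u : H) : Hnorm2 u = 1 -> Hmul (Hconj u) u = Hone.
Proof. intros Hu; rewrite Hmul_conj_l, Hu; reflexivity. Qed.

Lemma conj_unit_r (u : H) : Hnorm2 u = 1 -> Hmul u (Hconj u) = Hone.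
Proof. intros Hu; rewrite Hmul_conj_r, Hu; reflexivity. Qed.

Lemma rot_mul (u : H) (a b : C) :
  Hnorm2 u = 1 -> Hmul (rot u a) (rot u b) = rot u (a * b)%C.
Proof.
intros Hu; unfold rot; rewrite emb_mul.
transitivity (Hmul u (Hmul (emb a) (Hmul (Hmul (Hconj u) u) (Hmul (emb b) (Hconj u))))).
- now rewrite !Hmul_assoc.
- rewrite conj_unit_l, Hmul_1_l by easy; now rewrite !Hmul_assoc.
Qed.

Lemma rot_pow (u : H) (w : C) k :
  Hnorm2 u = 1 -> Hpow (rot u w) k = rot u (w ^ k)%C.
Proof.
intros Hu; induction k as [|k IH]; simpl.
- unfold rot; now rewrite emb_one, Hmul_1_l, conj_unit_r.
- now rewrite IH, rot_mul.
Qed.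

Lemma Hnorm_unit (u : H) : Hnorm2 u = 1 -> Hnorm u = 1.
Proof. intros Hu; unfold Hnorm; rewrite Hu; apply sqrt_1. Qed.

Lemma Hnorm_rot (u : H) (w : C) : Hnorm2 u = 1 -> Hnorm (rot u w) = Cmod w.
Proof.
intros Hu; unfold rot.
rewrite !Hnorm_mul, Hnorm_conj, Hnorm_emb, Hnorm_unit by easy; ring.
Qed.

Lemma rot_real (u : H) (x : R) : Hnorm2 u = 1 -> rot u (RtoC x) = mkH x 0 0 0.
Proof.
intros Hu; transitivity (Hmul (mkH x 0 0 0) (Hmul u (Hconj u))).
- unfold rot, emb; simpl; hring.
- rewrite conj_unit_r by easy; apply Hmul_1_r.
Qed.

(* If [v] is the vector part of [z] and [s = |v|], then [v (v + s i) = (v + s i) s i]. *)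
Lemma every_point_in_slice (z : H) : exists u w, Hnorm2 u = 1 /\ z = rot u w.
Proof.
destruct z as [a b c d].
(* If [c = d = 0], the point is already complex. Setting this case aside also ensures that [v] below
   is nonzero, even when [b] is negative. *)
assert (Hcase : (c = 0 /\ d = 0) \/ 0 < c ^ 2 + d ^ 2).
{ destruct (Req_dec c 0), (Req_dec d 0); [now left|right; nra..]. }
destruct Hcase as [[-> ->]|Hcd].
- exists Hone, (a, b); split; [hring|].
  unfold rot, emb; simpl; hring.
- set (s := sqrt (b ^ 2 + c ^ 2 + d ^ 2)).
  assert (Hs : s ^ 2 = b ^ 2 + c ^ 2 + d ^ 2) by (apply pow2_sqrt; nra).
  set (v := mkH 0 (b + s) c d).
  assert (Hv : 0 < Hnorm2 v) by (unfold Hnorm2, v; simpl; nra).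
  set (n := Hnorm v).
  assert (Hn : n ^ 2 = Hnorm2 v) by apply Hnorm_sqr.
  assert (Hn0 : 0 < n) by (apply sqrt_lt_R0; exact Hv).
  set (u := Hmul (mkH (/ n) 0 0 0) v).
  assert (Hu : Hnorm2 u = 1).
  { unfold u; rewrite Hnorm2_mul, <- Hn; unfold Hnorm2; simpl; field; lra. }
  assert (Hzu : Hmul (mkH a b c d) u = Hmul u (emb (a, s))).
  { unfold u, v, emb, Hmul; simpl.
    apply f_equal4; try ring.
    (* Only the real component is left; it is the equation defining [s]. *)
    apply Rminus_diag_uniq.
    transitivity (/ n * (s ^ 2 - (b ^ 2 + c ^ 2 + d ^ 2))); [ring|].
    rewrite Hs; ring. }
  exists u, (a, s); split; [exact Hu|].
  unfold rot; rewrite Hmul_assoc, <- Hzu, <- Hmul_assoc, conj_unit_r by easy.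
  now rewrite Hmul_1_r.
Qed.

(** The best [S] is the squared Hardy norm of the combination of Szego kernels whose Taylor
    coefficients are [x a^k + y b^k + t c^k]. Bounding partial sums avoids any reference to a
    limit. *)
Definition szego_dominated (g : C -> C) : Prop :=
  forall (a b c x y t : C) (S : R),
    Cmod a < 1 -> Cmod b < 1 -> Cmod c < 1 ->
    (forall n, sum_f_R0 (fun k => Cmod (x * a ^ k + y * b ^ k + t * c ^ k)%C ^ 2) n <= S) ->
    Cmod (x * g a + y * g b + t * g c)%C ^ 2 <= S.

(** Only a left factor is attached: complex weights act from the left, and [Hconj u] moves the slice
    to the standard complex plane. *)
Definition slice_fun (f : H -> H) (u : H) (w : C) : H := Hmul (Hconj u) (f (rot u w)).

(** The Pick weights are [x], [y], [t], each times [Hconj u]. Since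
    [Hconj u (rot u a)^k = a^k Hconj u], the kernel side becomes a complex sum times the unit
    [Hconj u]. *)
Lemma slice_norm_le (f : H -> H) (u : H) (a b c x y t : C) (S : R) :
  pick_hyp f -> Hnorm2 u = 1 ->
  Cmod a < 1 -> Cmod b < 1 -> Cmod c < 1 ->
  (forall n, sum_f_R0 (fun k => Cmod (x * a ^ k + y * b ^ k + t * c ^ k)%C ^ 2) n <= S) ->
  Hnorm2 (Hadd (Hadd (Hmul (emb x) (slice_fun f u a)) (Hmul (emb y) (slice_fun f u b)))
               (Hmul (emb t) (slice_fun f u c))) <= S.
Proof.
intros Hf Hu Ha Hb Hc HS.
set (tri := fun (p q r : C) (i : nat) =>
  match i with O => p | Datatypes.S O => q | _ => r end).
assert (H1 := pick_norm_le f (fun i => Hmul (emb (tri x y t i)) (Hconj u))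
                (fun i => rot u (tri a b c i)) S Hf).
replace (Hadd (Hadd (Hmul (emb x) (slice_fun f u a)) (Hmul (emb y) (slice_fun f u b)))
              (Hmul (emb t) (slice_fun f u c)))
  with (Hsum 3 (fun i => Hmul (Hmul (emb (tri x y t i)) (Hconj u)) (f (rot u (tri a b c i))))).
2:{ simpl; unfold slice_fun; rewrite !Hmul_assoc.
    repeat match goal with |- context [Hmul (Hmul ?p ?q) ?r] =>
      generalize (Hmul (Hmul p q) r); intros end.
    hring. }
apply H1.
- intros i _; unfold inB; rewrite Hnorm_rot by easy.
  destruct i as [|[|i]]; simpl; assumption.
- intros n; eapply Rle_trans; [right|apply (HS n)].
  apply sum_eq; intros k _.
  replace (Hsum 3 _) with (Hmul (emb (x * a ^ k + y * b ^ k + t * c ^ k)%C) (Hconj u)).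
  + rewrite Hnorm2_mul, Hnorm2_conj, Hu, <- Hnorm_sqr, Hnorm_emb; ring.
  + assert (Hr : forall p w, Hmul (Hmul (emb p) (Hconj u)) (Hpow (rot u w) k)
                             = Hmul (emb (p * w ^ k)%C) (Hconj u)).
    { intros p w; rewrite rot_pow by easy; unfold rot.
      rewrite emb_mul, <- !Hmul_assoc; f_equal; rewrite !Hmul_assoc.
      now rewrite conj_unit_l, Hmul_1_l. }
    simpl; rewrite !Hr, !emb_add, !Hmul_add_l.
    repeat match goal with |- context [Hmul ?p ?q] => generalize (Hmul p q); intros end.
    hring.
Qed.

(** * Divided differences of the complex components *)

Lemma Cmod_hfst_le (q : H) : Cmod (hfst q) ^ 2 <= Hnorm2 q.
Proof. rewrite Hnorm2_split; nra. Qed.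

Lemma Cmod_hsnd_le (q : H) : Cmod (hsnd q) ^ 2 <= Hnorm2 q.
Proof. rewrite Hnorm2_split; nra. Qed.

Lemma slice_hfst_dominated (f : H -> H) (u : H) :
  pick_hyp f -> Hnorm2 u = 1 -> szego_dominated (fun w => hfst (slice_fun f u w)).
Proof.
intros Hf Hu a b c x y t S Ha Hb Hc HS.
eapply Rle_trans; [|exact (slice_norm_le f u a b c x y t S Hf Hu Ha Hb Hc HS)].
eapply Rle_trans; [|apply Cmod_hfst_le].
rewrite <- !hfst_mul; right; reflexivity.
Qed.

Lemma slice_hsnd_dominated (f : H -> H) (u : H) :
  pick_hyp f -> Hnorm2 u = 1 -> szego_dominated (fun w => hsnd (slice_fun f u w)).
Proof.
intros Hf Hu a b c x y t S Ha Hb Hc HS.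
eapply Rle_trans; [|exact (slice_norm_le f u a b c x y t S Hf Hu Ha Hb Hc HS)].
eapply Rle_trans; [|apply Cmod_hsnd_le].
rewrite <- !hsnd_mul; right; reflexivity.
Qed.

Lemma dominated_geometric (g : C -> C) (a b c x y t : C) (K q : R) :
  szego_dominated g -> Cmod a < 1 -> Cmod b < 1 -> Cmod c < 1 ->
  0 <= K -> 0 <= q < 1 ->
  (forall k, Cmod (x * a ^ k + y * b ^ k + t * c ^ k)%C <= K * q ^ k) ->
  Cmod (x * g a + y * g b + t * g c)%C <= K / (1 - q).
Proof.
intros Hg Ha Hb Hc HK Hq Hk.
assert (HKq : 0 <= K / (1 - q)) by (apply Rdiv_le_0_compat; lra).
assert (H1 : Cmod (x * g a + y * g b + t * g c)%C ^ 2 <= (K / (1 - q)) ^ 2).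
{ apply Hg; try assumption; intros n.
  apply Rle_trans with (sum_f_R0 (fun k => K ^ 2 * (q ^ k * q ^ k)) n).
  - apply sum_Rle; intros k _.
    specialize (Hk k); assert (H0 := Cmod_ge_0 (x * a ^ k + y * b ^ k + t * c ^ k)%C).
    replace (K ^ 2 * (q ^ k * q ^ k)) with ((K * q ^ k) ^ 2) by ring.
    now apply pow_incr.
  (* The denominator [(1 - q) ^ 2] replaces the exact [1 - q ^ 2] so that the final bound is a
     perfect square. With [p = q ^ (n + 1)] the induction step amounts to [p (1 - q) <= 1]. *)
  - assert (Hs : sum_f_R0 (fun k => K ^ 2 * (q ^ k * q ^ k)) n
      <= K ^ 2 * ((1 - q ^ S n) / (1 - q) ^ 2)).
    { induction n as [|n IH].
      - simpl; replace ((1 - q * 1) / ((1 - q) * ((1 - q) * 1))) with (/ (1 - q))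
          by (field; lra).
        apply Rmult_le_compat_l; [nra|].
        replace (1 * 1) with (/ 1) by field; apply Rinv_le_contravar; lra.
      - rewrite tech5.
        eapply Rle_trans; [apply Rplus_le_compat_r, IH|].
        rewrite <- Rmult_plus_distr_l; apply Rmult_le_compat_l; [nra|].
        assert (Hp : 0 <= q ^ S n <= 1).
        { split; [apply pow_le; lra|rewrite <- (pow1 (S n)); apply pow_incr; lra]. }
        set (p := q ^ S n) in *.
        replace (q ^ S (S n)) with (q * p) by (unfold p; simpl; ring).
        apply Rmult_le_reg_r with ((1 - q) ^ 2); [nra|].
        replace (((1 - p) / (1 - q) ^ 2 + p * p) * (1 - q) ^ 2)
          with ((1 - p) + p * p * (1 - q) ^ 2) by (field; lra).
        replace ((1 - q * p) / (1 - q) ^ 2 * (1 - q) ^ 2)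
          with (1 - q * p) by (field; lra).
        assert (p * (1 - q) * (p * (1 - q)) <= p * (1 - q) * 1); [|nra].
        apply Rmult_le_compat_l; nra. }
    eapply Rle_trans; [exact Hs|].
    replace ((K / (1 - q)) ^ 2) with (K ^ 2 * (1 / (1 - q) ^ 2)) by (field; lra).
    apply Rmult_le_compat_l; [nra|].
    apply Rmult_le_compat_r; [left; apply Rinv_0_lt_compat, pow_lt; lra|].
    assert (0 <= q ^ S n) by (apply pow_le; lra); lra. }
assert (H0 := Cmod_ge_0 (x * g a + y * g b + t * g c)%C).
apply Rsqr_incr_0_var; [|easy]; rewrite !Rsqr_pow2; exact H1.
Qed.

(* [pow_diff1 a b k] and [pow_diff2 a b c k] are the divided differences
   of [w ^ k] at [a, b] and at [a, b, c]. *)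
Fixpoint pow_diff1 (a b : C) (k : nat) : C :=
  match k with O => 0%C | S k => (a ^ k + b * pow_diff1 a b k)%C end.

Fixpoint pow_diff2 (a b c : C) (k : nat) : C :=
  match k with O => 0%C | S k => (pow_diff1 a b k + c * pow_diff2 a b c k)%C end.

Lemma pow_diff1_eq (a b : C) k : (a ^ k - b ^ k)%C = ((a - b) * pow_diff1 a b k)%C.
Proof.
induction k as [|k IH]; simpl; [ring|].
replace (a * a ^ k - b * b ^ k)%C with ((a - b) * a ^ k + b * (a ^ k - b ^ k))%C by ring.
rewrite IH; ring.
Qed.

Lemma pow_diff2_eq (a b c : C) k :
  ((b - c) * a ^ k + (c - a) * b ^ k + (a - b) * c ^ k)%C
  = ((b - a) * (b - c) * (c - a) * pow_diff2 a b c k)%C.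
Proof.
induction k as [|k IH]; simpl; [ring|].
transitivity (c * ((b - c) * a ^ k + (c - a) * b ^ k + (a - b) * c ^ k)
              - (b - c) * (c - a) * (a ^ k - b ^ k))%C; [ring|].
rewrite IH, pow_diff1_eq; ring.
Qed.

(** The divided difference grows like [k r^(k-1)]; the larger base [q] absorbs the factor [k]. The
    constant is the one for which [q^k + r C q^k = C q^(k+1)]. *)
Lemma pow_diff1_le (a b : C) (r q : R) k :
  0 <= r < q -> Cmod a <= r -> Cmod b <= r ->
  Cmod (pow_diff1 a b k) <= / (q - r) * q ^ k.
Proof.
intros Hr Ha Hb.
assert (Hi : 0 < / (q - r)) by (apply Rinv_0_lt_compat; lra).
induction k as [|k IH]; simpl; [rewrite Cmod_0; lra|].
eapply Rle_trans; [apply Cmod_triangle|]; rewrite Cmod_mult, Cmod_pow.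
assert (H1 : Cmod a ^ k <= q ^ k) by (apply pow_incr; split; [apply Cmod_ge_0|lra]).
assert (H2 : Cmod b * Cmod (pow_diff1 a b k) <= r * (/ (q - r) * q ^ k))
  by (apply Rmult_le_compat; [apply Cmod_ge_0|apply Cmod_ge_0|easy|easy]).
replace (/ (q - r) * (q * q ^ k)) with (q ^ k + r * (/ (q - r) * q ^ k))
  by (field; lra).
lra.
Qed.

Lemma pow_diff2_le (a b c : C) (r q : R) k :
  0 <= r < q -> Cmod a <= r -> Cmod b <= r -> Cmod c <= r ->
  Cmod (pow_diff2 a b c k) <= / (q - r) ^ 2 * q ^ k.
Proof.
intros Hr Ha Hb Hc.
assert (Hi : 0 < / (q - r) ^ 2) by (apply Rinv_0_lt_compat, pow_lt; lra).
induction k as [|k IH]; [simpl pow_diff2; rewrite Cmod_0, pow_O; lra|]; simpl pow_diff2.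
eapply Rle_trans; [apply Cmod_triangle|]; rewrite Cmod_mult.
assert (H1 := pow_diff1_le a b r q k Hr Ha Hb).
assert (H2 : Cmod c * Cmod (pow_diff2 a b c k) <= r * (/ (q - r) ^ 2 * q ^ k))
  by (apply Rmult_le_compat; [apply Cmod_ge_0|apply Cmod_ge_0|easy|easy]).
replace (/ (q - r) ^ 2 * q ^ S k)
  with (/ (q - r) * q ^ k + r * (/ (q - r) ^ 2 * q ^ k)) by (simpl; field; lra).
lra.
Qed.

(** The weights [1, -1] and [b - c, c - a, a - b] turn the kernel coefficients into divided
    differences of powers times the product of the node differences. That product factors out, so
    coinciding nodes cause no division by zero. *)
Lemma dominated_bounded_differences (g : C -> C) (r q : R) :
  szego_dominated g -> 0 <= r < q -> q < 1 ->
  bounded_differences g r (/ (q - r) / (1 - q)) (/ (q - r) ^ 2 / (1 - q)).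
Proof.
intros Hg Hr Hq.
constructor.
- intros a b Ha Hb.
  (* The third node is [0] with weight [0]. *)
  replace (g a - g b)%C with (1 * g a + - (1) * g b + 0 * g 0)%C by ring.
  eapply Rle_trans; [apply (dominated_geometric g _ _ _ _ _ _ (Cmod (a - b) * / (q - r)) q);
    try easy; try lra|].
  + rewrite Cmod_0; lra.
  + apply Rmult_le_pos; [apply Cmod_ge_0|left; apply Rinv_0_lt_compat; lra].
  + intros k.
    replace (1 * a ^ k + - (1) * b ^ k + 0 * 0 ^ k)%C with (a ^ k - b ^ k)%C by ring.
    rewrite pow_diff1_eq, Cmod_mult, Rmult_assoc.
    apply Rmult_le_compat_l; [apply Cmod_ge_0|now apply pow_diff1_le].
  + right; field; lra.
- intros a b c Ha Hb Hc.
  replace ((g b - g a) * (c - a) - (b - a) * (g c - g a))%C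
    with ((b - c) * g a + (c - a) * g b + (a - b) * g c)%C by ring.
  set (D := ((b - a) * (b - c) * (c - a))%C).
  eapply Rle_trans; [apply (dominated_geometric g _ _ _ _ _ _ (Cmod D * / (q - r) ^ 2) q);
    try easy; try lra|].
  + apply Rmult_le_pos; [apply Cmod_ge_0|left; apply Rinv_0_lt_compat, pow_lt; lra].
  + intros k; rewrite pow_diff2_eq; fold D; rewrite Cmod_mult, Rmult_assoc.
    apply Rmult_le_compat_l; [apply Cmod_ge_0|now apply pow_diff2_le].
  + unfold D; rewrite !Cmod_mult; right; field; lra.
Qed.

(** * Power series on one slice *)

Lemma csum_series (a : nat -> C) (l : C) (K q : R) :
  0 <= q < 1 -> (forall n, Cmod (csum n a - l) <= q ^ n / K) -> 0 < K ->
  infinite_sum (fun k => fst (a k)) (fst l) /\ infinite_sum (fun k => snd (a k)) (snd l).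
Proof.
intros Hq Ha HK.
assert (Hlim : forall e, 0 < e -> exists N, forall n, (N <= n)%nat ->
  Cmod (csum (S n) a - l) < e).
{ intros e He.
  destruct (pow_lt_1_zero q ltac:(rewrite Rabs_pos_eq; lra) (e * K)
    ltac:(now apply Rmult_lt_0_compat)) as [N HN].
  exists N; intros n Hn; eapply Rle_lt_trans; [apply Ha|].
  specialize (HN (S n) ltac:(lia)).
  rewrite Rabs_pos_eq in HN by (apply pow_le; lra).
  apply Rmult_lt_reg_r with K; [easy|].
  unfold Rdiv; rewrite Rmult_assoc, Rinv_l, Rmult_1_r; lra. }
(* [sum_f_R0] includes the term of index [n], hence the shift to [S n]. *)
assert (Hfst : forall n, sum_f_R0 (fun k => fst (a k)) n = fst (csum (S n) a)).
{ induction n as [|n IH]; [simpl; ring|]; rewrite tech5, IH; reflexivity. }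
assert (Hsnd : forall n, sum_f_R0 (fun k => snd (a k)) n = snd (csum (S n) a)).
{ induction n as [|n IH]; [simpl; ring|]; rewrite tech5, IH; reflexivity. }
split; intros e He; destruct (Hlim e He) as [N HN]; exists N; intros n Hn;
  (eapply Rle_lt_trans; [|exact (HN n Hn)]); unfold Rdist.
- rewrite Hfst; apply (re_le_Cmod (csum (S n) a - l)).
- rewrite Hsnd; apply (im_le_Cmod (csum (S n) a - l)).
Qed.

(** The two complex components of [slice_fun f u] are expanded separately and reassembled; the left
    factor [u] undoes [Hconj u]. The constant 2 is a convenient bound for the factor [sqrt 2]
    produced by two components. *)
Lemma slice_power_series (f : H -> H) (u : H) (r : R) :
  pick_hyp f -> Hnorm2 u = 1 -> 0 < r < 1 ->
  exists c : nat -> H,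
    (forall k, Hnorm (c k) <= 2 * (/ r) ^ k) /\
    forall w, Cmod w < r ->
      Hseries (fun k => Hmul (Hpow (rot u w) k) (c k)) (f (rot u w)).
Proof.
intros Hf Hu Hr.
set (G := slice_fun f u).
set (q := (r + 1) / 2).
assert (Hq : 0 <= r < q) by (unfold q; lra).
assert (Hq1 : q < 1) by (unfold q; lra).
assert (Hb1 := dominated_bounded_differences _ r q (slice_hfst_dominated f u Hf Hu) Hq Hq1).
assert (Hb2 := dominated_bounded_differences _ r q (slice_hsnd_dominated f u Hf Hu) Hq Hq1).
assert (HM1 : 0 <= / (q - r) / (1 - q)).
{ apply Rdiv_le_0_compat; [left; apply Rinv_0_lt_compat; lra|lra]. }
assert (HM2 : 0 <= / (q - r) ^ 2 / (1 - q)).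
{ apply Rdiv_le_0_compat; [left; apply Rinv_0_lt_compat, pow_lt; lra|lra]. }
assert (HG : forall w, Cmod w <= r -> Hnorm2 (G w) <= 1).
{ intros w Hw; unfold G, slice_fun; rewrite Hnorm2_mul, Hnorm2_conj, Hu, Rmult_1_l.
  assert (H1 : Hnorm (f (rot u w)) <= 1).
  { apply pick_contractive; [easy|]; unfold inB; rewrite Hnorm_rot by easy; lra. }
  assert (H0 := Hnorm_pos (f (rot u w))); rewrite <- Hnorm_sqr; nra. }
destruct (complex_power_series _ r _ _ Hb1 HM1 HM2 ltac:(lra)) as (c1 & Hc1 & Hs1).
{ intros w Hw; specialize (HG w Hw); fold G.
  assert (H0 := Cmod_ge_0 (hfst (G w))); assert (H1 := Cmod_hfst_le (G w)); nra. }
destruct (complex_power_series _ r _ _ Hb2 HM1 HM2 ltac:(lra)) as (c2 & Hc2 & Hs2).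
{ intros w Hw; specialize (HG w Hw); fold G.
  assert (H0 := Cmod_ge_0 (hsnd (G w))); assert (H1 := Cmod_hsnd_le (G w)); nra. }
exists (fun k => Hmul u (hpair (c1 k) (c2 k))); split.
- intros k; rewrite Hnorm_mul, Hnorm_unit, Rmult_1_l by easy.
  assert (Hp : 0 < (/ r) ^ k) by (apply pow_lt, Rinv_0_lt_compat; lra).
  apply Hnorm_le_of_sqr; [lra|].
  rewrite Hnorm2_split.
  replace (hfst (hpair (c1 k) (c2 k))) with (c1 k) by (unfold hfst; simpl; now destruct (c1 k)).
  replace (hsnd (hpair (c1 k) (c2 k))) with (c2 k) by (unfold hsnd; simpl; now destruct (c2 k)).
  specialize (Hc1 k); specialize (Hc2 k).
  assert (H1 := Cmod_ge_0 (c1 k)); assert (H2 := Cmod_ge_0 (c2 k)); nra.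
- intros w Hw.
  set (tau := Cmod w / r).
  assert (Htau : 0 <= tau < 1).
  { assert (H0 := Cmod_ge_0 w); unfold tau; split.
    - apply Rdiv_le_0_compat; lra.
    - apply Rmult_lt_reg_r with r; [lra|].
      unfold Rdiv; rewrite Rmult_assoc, Rinv_l; lra. }
  destruct (csum_series _ _ _ _ Htau (Hs1 w Hw) ltac:(fold tau; lra)) as [S0 S1].
  destruct (csum_series _ _ _ _ Htau (Hs2 w Hw) ltac:(fold tau; lra)) as [S2 S3].
  assert (Hser : Hseries (fun k => hpair (w ^ k * c1 k)%C (w ^ k * c2 k)%C) (G w))
    by (repeat split; assumption).
  apply (Hseries_mul_l u) in Hser.
  replace (Hmul u (G w)) with (f (rot u w)) in Hser
    by (unfold G, slice_fun; now rewrite Hmul_assoc, conj_unit_r, Hmul_1_l).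
  revert Hser; apply Hseries_ext; intros k.
  rewrite rot_pow, hpair_mul by easy; unfold rot.
  (* Inserting [Hconj u * u = 1] makes the power of [rot u w] appear on the left of the
     coefficient. *)
  transitivity (Hmul u (Hmul (emb (w ^ k)%C) (Hmul (Hmul (Hconj u) u) (hpair (c1 k) (c2 k))))).
  + now rewrite conj_unit_l, Hmul_1_l.
  + now rewrite !Hmul_assoc.
Qed.

(** * Uniqueness of the coefficients and passage to the whole ball *)

Lemma Hpow_real (x : R) k : Hpow (mkH x 0 0 0) k = mkH (x ^ k) 0 0 0.
Proof.
induction k as [|k IH]; simpl; [reflexivity|].
rewrite IH; unfold Hmul; simpl; apply f_equal4; ring.
Qed.

Lemma real_power_series_unique (a b : nat -> R) (l : R -> R) (r : R) :
  0 < r ->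
  (forall x, Rabs x < r -> infinite_sum (fun k => x ^ k * a k) (l x)) ->
  (forall x, Rabs x < r -> infinite_sum (fun k => x ^ k * b k) (l x)) ->
  forall k, a k = b k.
Proof.
intros Hr Ha Hb k.
assert (HP : forall d, (forall x, Rabs x < r -> infinite_sum (fun k => x ^ k * d k) (l x)) ->
  (forall x, Rabs x < r -> is_pseries d x (l x))).
{ intros d Hd x Hx; apply is_pseries_R, is_series_Reals.
  apply (infinite_sum_ext (fun k => x ^ k * d k)); [intros; ring|now apply Hd]. }
assert (HR : forall d, (forall x, Rabs x < r -> infinite_sum (fun k => x ^ k * d k) (l x)) ->
  Rbar_lt 0 (CV_radius d)).
(* The radius of convergence is at least [r / 2]: otherwise the terms at [r / 2] would not tend to
   zero, although the series converges there. *)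
{ intros d Hd; apply Rbar_lt_le_trans with (Finite (r / 2)); [simpl; lra|].
  apply Rbar_not_lt_le; intros Hlt.
  apply (CV_disk_outside d (r / 2)).
  - rewrite Rabs_pos_eq by lra; exact Hlt.
  - apply (is_lim_seq_ext (fun k => (r / 2) ^ k * d k)); [intros; ring|].
    apply ex_series_lim_0; exists (l (r / 2)); apply is_series_Reals, Hd.
    rewrite Rabs_pos_eq; lra. }
apply PSeries_ext_recip; [now apply HR|now apply HR|].
exists (mkposreal r Hr); intros x Hx.
assert (Hx' : Rabs x < r).
{ revert Hx; unfold ball; simpl; unfold AbsRing_ball, abs, minus, plus, opp; simpl.
  now rewrite Ropp_0, Rplus_0_r. }
rewrite (is_pseries_unique _ _ _ (HP a Ha x Hx')).
now rewrite (is_pseries_unique _ _ _ (HP b Hb x Hx')).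
Qed.

(** At real points the powers are scalars, so the series splits into four real power series. *)
Lemma H_power_series_unique (f : H -> H) (c d : nat -> H) (r : R) :
  0 < r ->
  (forall x, Rabs x < r ->
     Hseries (fun k => Hmul (Hpow (mkH x 0 0 0) k) (c k)) (f (mkH x 0 0 0))) ->
  (forall x, Rabs x < r ->
     Hseries (fun k => Hmul (Hpow (mkH x 0 0 0) k) (d k)) (f (mkH x 0 0 0))) ->
  forall k, c k = d k.
Proof.
intros Hr Hc Hd k.
assert (Hcomp : forall e, (forall x, Rabs x < r ->
     Hseries (fun k => Hmul (Hpow (mkH x 0 0 0) k) (e k)) (f (mkH x 0 0 0))) ->
  forall x, Rabs x < r ->
    infinite_sum (fun k => x ^ k * q0 (e k)) (q0 (f (mkH x 0 0 0))) /\
    infinite_sum (fun k => x ^ k * q1 (e k)) (q1 (f (mkH x 0 0 0))) /\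
    infinite_sum (fun k => x ^ k * q2 (e k)) (q2 (f (mkH x 0 0 0))) /\
    infinite_sum (fun k => x ^ k * q3 (e k)) (q3 (f (mkH x 0 0 0)))).
{ intros e He x Hx; destruct (He x Hx) as (H0 & H1 & H2 & H3).
  repeat split; [revert H0|revert H1|revert H2|revert H3]; apply infinite_sum_ext;
    intros m; rewrite Hpow_real; simpl; ring. }
assert (H0 : q0 (c k) = q0 (d k)).
{ apply (real_power_series_unique (fun k => q0 (c k)) (fun k => q0 (d k))
    (fun x => q0 (f (mkH x 0 0 0))) r Hr); intros x Hx; now apply Hcomp. }
assert (H1 : q1 (c k) = q1 (d k)).
{ apply (real_power_series_unique (fun k => q1 (c k)) (fun k => q1 (d k))
    (fun x => q1 (f (mkH x 0 0 0))) r Hr); intros x Hx; now apply Hcomp. }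
assert (H2 : q2 (c k) = q2 (d k)).
{ apply (real_power_series_unique (fun k => q2 (c k)) (fun k => q2 (d k))
    (fun x => q2 (f (mkH x 0 0 0))) r Hr); intros x Hx; now apply Hcomp. }
assert (H3 : q3 (c k) = q3 (d k)).
{ apply (real_power_series_unique (fun k => q3 (c k)) (fun k => q3 (d k))
    (fun x => q3 (f (mkH x 0 0 0))) r Hr); intros x Hx; now apply Hcomp. }
destruct (c k), (d k); simpl in *; now subst.
Qed.

(* Real points belong to every slice, so the coefficients depend neither on
   the slice nor on the radius. *)
Lemma global_power_series (f : H -> H) :
  pick_hyp f ->
  exists c : nat -> H,
    (forall k, Hnorm (c k) <= 2) /\
    forall z, inB z -> Hseries (fun k => Hmul (Hpow z k) (c k)) (f z).
Proof.
intros Hf.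
assert (H1 : Hnorm2 Hone = 1) by hring.
destruct (slice_power_series f Hone (1 / 2) Hf H1 ltac:(lra)) as (c & Hcb & Hc).
exists c.
assert (Huniq : forall u r, Hnorm2 u = 1 -> 0 < r < 1 ->
  (forall k, Hnorm (c k) <= 2 * (/ r) ^ k) /\
  forall w, Cmod w < r ->
    Hseries (fun k => Hmul (Hpow (rot u w) k) (c k)) (f (rot u w))).
{ intros u r Hu Hr.
  destruct (slice_power_series f u r Hf Hu Hr) as (d & Hdb & Hd).
  assert (Hcd : forall k, c k = d k).
  { set (s := Rmin r (1 / 2)).
    assert (Hsr : s <= r) by apply Rmin_l.
    assert (Hs2 : s <= 1 / 2) by apply Rmin_r.
    apply (H_power_series_unique f c d s).
    - apply Rmin_glb_lt; lra.
    - intros x Hx; rewrite <- (rot_real Hone x H1); apply Hc; rewrite Cmod_R; lra.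
    - intros x Hx; rewrite <- (rot_real u x Hu); apply Hd; rewrite Cmod_R; lra. }
  split.
  - intros k; rewrite Hcd; apply Hdb.
  - intros w Hw; eapply Hseries_ext; [|apply (Hd w Hw)].
    intros k; simpl; now rewrite Hcd. }
split.
- intros k.
  (* The coefficients do not depend on the radius [r], so [r = 1 - e] may tend to 1 in the bound
     [2 r^(-k)]; Bernoulli's inequality makes this quantitative. *)
  assert (Hlim : forall e, 0 < e < 1 -> (1 - e) ^ k * Hnorm (c k) <= 2).
  { intros e He; destruct (Huniq Hone (1 - e) H1 ltac:(lra)) as [Hb _].
    specialize (Hb k); rewrite pow_inv in Hb.
    assert (Hp : 0 < (1 - e) ^ k) by (apply pow_lt; lra).
    apply Rmult_le_compat_l with (r := (1 - e) ^ k) in Hb; [|lra].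
    replace ((1 - e) ^ k * (2 * / (1 - e) ^ k)) with 2 in Hb by (field; lra).
    exact Hb. }
  apply (Rle_of_eps _ _ (INR k * Hnorm (c k))); intros e He.
  assert (Hbern : 1 - INR k * e <= (1 - e) ^ k).
  { clear - He; induction k as [|k IH]; [simpl; lra|].
    rewrite S_INR; simpl; assert (H0 := pos_INR k).
    apply Rmult_le_compat_l with (r := 1 - e) in IH; [|lra]; nra. }
  specialize (Hlim e He); assert (H0 := Hnorm_pos (c k)).
  apply Rmult_le_compat_r with (r := Hnorm (c k)) in Hbern; [|easy]; lra.
- intros z Hz.
  destruct (every_point_in_slice z) as (u & w & Hu & ->).
  unfold inB in Hz; rewrite Hnorm_rot in Hz by easy; assert (H0 := Cmod_ge_0 w).
  apply (Huniq u ((Cmod w + 1) / 2) Hu ltac:(lra)); lra.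
Qed.

Theorem theorem1p3 (f : H -> H) :
  (forall z : nat -> H, (forall i, (i < 3)%nat -> inB (z i)) ->
     forall P : Hmat, is_Pick_matrix f 3 z P -> Hpsd 3 P) ->
  left_Schur f.
Proof.
intros Hf.
destruct (global_power_series f Hf) as (c & Hcb & Hc).
exists c; split; [|split].
- intros e He.
  (* The coefficients are bounded by 2, which [(1 + e) ^ k] eventually exceeds. *)
  destruct (Pow_x_infinity (1 + e) ltac:(rewrite Rabs_pos_eq; lra) 2) as [N HN].
  exists N; intros k Hk; eapply Rle_trans; [apply Hcb|].
  specialize (HN k Hk); rewrite Rabs_pos_eq in HN by (apply pow_le; lra); lra.
- intros z Hz; split; [|now apply Hc].
  assert (H0 := Hnorm_pos z); unfold inB in Hz.
  exists (Series (fun k => Hnorm (Hmul (Hpow z k) (c k)))).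
  apply (infinite_sum_dominated _ (fun k => 2 * Hnorm z ^ k)).
  + intros k; rewrite Rabs_pos_eq by apply Hnorm_pos.
    rewrite Hnorm_mul, Hnorm_pow, Rmult_comm.
    apply Rmult_le_compat_r; [now apply pow_le|apply Hcb].
  + apply (ex_series_scal_l 2 (fun k => Hnorm z ^ k)), ex_series_geom.
    rewrite Rabs_pos_eq; lra.
- intros z Hz; now apply pick_contractive.
Qed.
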